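(* Fix $\theta\in(1/2,7/8]$, $[\underline h,\bar h]\subset(0,1)$, $[\underline\alpha,\bar\alpha]\subset(0,1)$, $h_1\in(0,1]$, and integers $k\ge1$, $p\ge2$. Assume all $J_X\ge0$ (so both GKS inequalities hold), that the $J_X$ are independent with finite second moments and $\sum_X\mathrm{Var}(J_X)\le Cn$ for a constant $C$ independent of $n$, and let $C_P>0$ be a constant independent of $n,h_0,h_1,\alpha$ with $\mathbb E[(P_n-p_n)^2]\le C_P/n$ for all parameters. Then for all sufficiently large $n$, $$\int_{\underline h}^{\bar h}dh_0\int_{\underline\alpha}^{\bar\alpha}d\alpha\,\mathbb E\big\langle\big|Q_k^p-(\mathbb E\langle Q_k\rangle)^p\big|\big\rangle\le\frac{2pk}{(\tanh h_1)^{k/2}}\frac{(5C_P+40)^{1/4}}{n^{(\theta-1/2)/6}}.$$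
   Context: Spins $\boldsymbol\sigma\in\{-1,1\}^n$, $\sigma_X=\prod_{i\in X}\sigma_i$. Couplings $J_X$, $X\subset\{1,\dots,n\}$, independent; $\tau_1,\dots,\tau_n$ i.i.d. Poisson with mean $\alpha n^{\theta-1}$, independent of the couplings. Hamiltonian $\mathcal H(\boldsymbol\sigma)=-\sum_XJ_X\sigma_X-h_0\sum_i\sigma_i-h_1\sum_i\tau_i\sigma_i$, partition function $\mathcal Z$, Gibbs expectation $\langle\cdot\rangle$ depending on $h_0,h_1,\alpha$; for functions of $k$ replicas, $\langle\cdot\rangle$ is the expectation under the product of $k$ independent copies of the Gibbs measure. $Q_k=\frac1n\sum_i\sigma_i^{(1)}\cdots\sigma_i^{(k)}$. Pressure $P_n=\frac1n\ln\mathcal Z$, $p_n=\mathbb EP_n$, $\mathbb E$ over all $J_X$ and $\boldsymbol\tau$. GKS inequalities: $\langle\sigma_T\rangle\ge0$ and $\langle\sigma_T\sigma_S\rangle-\langle\sigma_T\rangle\langle\sigma_S\rangle\ge0$ for all $T,S$. *)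

(* Defs.v *)
From HB Require Import structures.
From mathcomp Require Import all_boot all_order all_algebra.
From mathcomp Require Import all_classical all_reals all_analysis.
Set Implicit Arguments. Unset Strict Implicit. Unset Printing Implicit Defensive.
Import Order.TTheory GRing.Theory Num.Theory.
Import numFieldNormedType.Exports.
Local Open Scope classical_set_scope.
Local Open Scope ring_scope.

Section Model.
Variable R : realType.

Definition tanh (x : R) : R := (expR x - expR (- x)) / (expR x + expR (- x)).

Section Spins.
Variable n : nat.

Definition config := {ffun 'I_n -> bool}.
Definition spin (b : bool) : R := if b then 1 else -1.
Definition sigmaX (s : config) (X : {set 'I_n}) : R := \prod_(i in X) spin (s i).

Variables (J : {set 'I_n} -> R) (tau : 'I_n -> nat) (h0 h1 : R).

Definition ham (s : config) : R :=
  - (\sum_(X : {set 'I_n}) J X * sigmaX s X)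
  - h0 * (\sum_(i < n) spin (s i))
  - h1 * (\sum_(i < n) (tau i)%:R * spin (s i)).

Definition gweight (s : config) : R := expR (- ham s).
Definition Zpart : R := \sum_(s : config) gweight s.

Definition gibbs (k : nat) (f : {ffun 'I_k -> config} -> R) : R :=
  \sum_(ss : {ffun 'I_k -> config})
     (\prod_(j < k) gweight (ss j)) * f ss / Zpart ^+ k.

Definition Qk (k : nat) (ss : {ffun 'I_k -> config}) : R :=
  n%:R^-1 * \sum_(i < n) \prod_(j < k) spin (ss j i).

Definition Pn : R := n%:R^-1 * ln Zpart.
End Spins.

Section Prob.
Context {d : measure_display} {T : measurableType d}.
Variable P : probability T R.

Definition Ex (F : T -> R) : \bar R := (\int[P]_w (F w)%:E)%E.
Definition Var (F : T -> R) : \bar R := Ex (fun w => (F w - fine (Ex F)) ^+ 2).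

Definition poisson_law (Y : T -> nat) (lam : R) : Prop :=
  forall m : nat, P (Y @^-1` [set m]) = (expR (- lam) * lam ^+ m / (m`!)%:R)%:E.

(* mutual independence of the finite family (J_X)_X together with (tau_i)_i:
   product rule for every choice of one measurable set per variable (choosing
   the whole space recovers every subfamily) *)
Definition indep_family (n : nat) (J : {set 'I_n} -> T -> R) (tau : 'I_n -> T -> nat) : Prop :=
  forall (B : {set 'I_n} -> set R) (C : 'I_n -> set nat),
    (forall X, measurable (B X)) ->
    P [set w | (forall X, B X (J X w)) /\ (forall i, C i (tau i w))] =
    ((\prod_(X : {set 'I_n}) fine (P (J X @^-1` B X))) *
     (\prod_(i < n) fine (P (tau i @^-1` C i))))%:E.
End Prob.
End Model.

(* Main.v *)
Require Import Defs.
From HB Require Import structures.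
From mathcomp Require Import all_boot all_order all_algebra.
From mathcomp Require Import all_classical all_reals all_analysis.
From mathcomp Require Import measurable_realfun ring lra.
Import Order.TTheory GRing.Theory Num.Theory.
Import numFieldNormedType.Exports.
Local Open Scope ring_scope.
Set Implicit Arguments. Unset Strict Implicit. Unset Printing Implicit Defensive.

(** The gap to the rate [n^-(theta-1/2)/6 >= n^-1/16] is large enough for a direct
    argument giving the rate [n^-1/8].  By the second GKS inequality,
    [<Q_k^2> - <Q_k>^2 <= k (<Q_1^2> - <Q_1>^2)], and the right-hand side is at most
    [8 k] times the increment of [<Q_1>] when [h_0] grows by [1/n].  The means
    [<sigma_i>] are nondecreasing in every coupling and in every [tau_i], hence so
    are [k <Q_1> - <Q_k>] and [k <Q_1> + <Q_k>]; Harris' inequality for the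
    independent disorder then gives [Var <Q_k> <= k^2 Var <Q_1>].  Convexity of the
    pressure in [h_0] and its concentration control [Var <Q_1>] by
    [18 C_P / (n delta^2)] plus twice the increment of [r(h_0) = E <Q_1>] over
    [h_0 - delta, h_0 + delta].  As [r] is monotone with values in [0, 1], these
    increments have integral at most [3 delta] over [h_0].  One takes
    [delta = n^-1/4], and [|x| <= eps / 2 + x^2 / (2 eps)] with [eps = n^-1/8]. *)

(** * The GKS inequalities *)

Section Spin.
Variables (R : realType) (n : nat).
Local Notation cfg := (config n).
Implicit Types (K : {set 'I_n} -> R) (S T X : {set 'I_n}) (s u : cfg).

(** For each [alpha] only the law of the Poisson variables is prescribed; nothing relates [tau] at
    two values of [alpha], so the integrand has no evident measurability in the parameters. Outer
    integrals of nonnegative functions are therefore only compared with majorants, and the one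
    function of [alpha] that is really integrated is [E <Q_1>], measurable as a limit of finite
    Poisson mixtures. In the field, a step function on a grid of mesh [delta] dominates the
    increments of a monotone function. Finite increments replace derivatives: changing one coupling
    brings in [cosh] and [sinh], and convexity of the pressure is the tangent bound for [exp]. Every
    field is a coupling on singletons, so one family of nonnegative couplings carries the whole
    model and GKS applies to it directly. With [eta = n^-1/16], [eps = eta^2] and [delta = eta^4],
    the terms [eps], [1 / (n delta^2 eps)] and [delta / eps] have orders [eta^2], [eta^6] and
    [eta^2]. The choice [delta = eps^2] balances the first and the last. Against a target of order
    at least [eta], one factor [eta] remains to absorb every constant in [k], [p], [C_P] and
    [h_1]. *)

Definition symd S T : {set 'I_n} := (S :\: T) :|: (T :\: S).

Lemma spin_sq b : spin R b * spin R b = 1.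
Proof. by case: b; rewrite /spin ?mulr1// mulrNN mulr1. Qed.

Lemma sigmaXE s T : sigmaX R s T = \prod_(i < n) (if i \in T then spin R (s i) else 1).
Proof. by rewrite /sigmaX big_mkcond. Qed.

Lemma sigmaX_mul s S T : sigmaX R s S * sigmaX R s T = sigmaX R s (symd S T).
Proof.
rewrite !sigmaXE -big_split/=; apply: eq_bigr => i _; rewrite !inE.
by case: (i \in S); case: (i \in T); rewrite /= ?mulr1 ?mul1r ?spin_sq.
Qed.

Lemma sigmaX_sqr s T : sigmaX R s T * sigmaX R s T = 1.
Proof. by rewrite sigmaXE -big_split/= big1// => i _; case: ifP; rewrite ?mulr1 ?spin_sq.
  Qed.

Lemma sigmaX_pm s T : sigmaX R s T = 1 \/ sigmaX R s T = -1.
Proof.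
have /eqP := sigmaX_sqr s T; rewrite -expr2 sqrf_eq1 => /orP[]/eqP; tauto.
Qed.

(** With [true] coding the spin +1, equality of booleans is multiplication of spins, so this is the
    sitewise product of two configurations. *)
Definition cmul s u : cfg := [ffun i => s i == u i].

Lemma sigmaX_cmul s u T : sigmaX R (cmul s u) T = sigmaX R s T * sigmaX R u T.
Proof.
rewrite !sigmaXE -big_split/=; apply: eq_bigr => i _; rewrite ffunE.
case: (i \in T); rewrite ?mulr1//.
by case: (s i); case: (u i); rewrite /spin/= ?mulr1 ?mul1r ?mulrNN ?mulr1.
Qed.

Lemma cmulK s : involutive (cmul s).
Proof. by move=> u; apply/ffunP => i; rewrite !ffunE; case: (s i); case: (u i). Qed.

Definition wK K s : R := expR (\sum_X K X * sigmaX R s X).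

Lemma wK_gt0 K s : 0 < wK K s. Proof. exact: expR_gt0. Qed.

Definition ch (x : R) := (expR x + expR (- x)) / 2.
Definition sh (x : R) := (expR x - expR (- x)) / 2.

Lemma ch_gt0 x : 0 < ch x.
Proof. by rewrite divr_gt0// addr_gt0// expR_gt0. Qed.

Lemma sh_ge0 x : 0 <= x -> 0 <= sh x.
Proof. by move=> x0; rewrite divr_ge0// subr_ge0 ler_expR; lra. Qed.

Lemma sh_lt_ch x : sh x < ch x.
Proof. rewrite /sh /ch; have := expR_gt0 (- x); lra. Qed.

Lemma expR_sigmaX x s T : expR (x * sigmaX R s T) = ch x + sh x * sigmaX R s T.
Proof. by rewrite /ch /sh; case: (sigmaX_pm s T) => ->; rewrite ?mulr1 ?mulrN1; lra. Qed.

(** The sum factorises over sites: a site of [T] contributes 0, any other site contributes 2. *)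
Lemma sum_sigmaX_ge0 T : 0 <= \sum_s sigmaX R s T.
Proof.
under eq_bigr do rewrite sigmaXE.
rewrite -(bigA_distr_bigA (fun i b => if i \in T then spin R b else 1)).
apply: prodr_ge0 => i _; rewrite big_bool; by case: (i \in T); rewrite ?subrr //= addr_ge0.
Qed.

(** High-temperature expansion: each Boltzmann factor is [ch + sh * sigma_X] with nonnegative
    coefficients. Expanding one coupling at a time either keeps [T] or replaces it by its symmetric
    difference with [X], which is why [T] varies in the induction. *)
Lemma griffiths1 K T : (forall X, 0 <= K X) -> 0 <= \sum_s sigmaX R s T * wK K s.
Proof.
move=> K0.
under eq_bigr do rewrite /wK expR_sum.
suff H (r : seq {set 'I_n}) :
    0 <= \sum_s sigmaX R s T * \prod_(X <- r) expR (K X * sigmaX R s X) by exact: H.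
elim: r T => [|X r IH] T.
  by under eq_bigr do rewrite big_nil mulr1; exact: sum_sigmaX_ge0.
under eq_bigr do rewrite big_cons expR_sigmaX.
rewrite (eq_bigr (fun s => ch (K X) * (sigmaX R s T * \prod_(i <- r) expR (K i * sigmaX R
  s i))
  + sh (K X) * (sigmaX R s (symd T X) * \prod_(i <- r) expR (K i * sigmaX R s i)))); last
    first.
  by move=> s _; rewrite -sigmaX_mul; ring.
rewrite big_split/= -!mulr_sumr addr_ge0// mulr_ge0//.
- exact/ltW/ch_gt0.
- exact/sh_ge0.
Qed.

(* With the second replica written [cmul s u], the difference is a combination, with
   weights [1 - u_T >= 0], of first-GKS sums for the couplings [K_X (1 + u_X)]. *)
Lemma griffiths2 K S T : (forall X, 0 <= K X) ->
  (\sum_s sigmaX R s S * wK K s) * (\sum_s sigmaX R s T * wK K s) <=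
  (\sum_s sigmaX R s (symd S T) * wK K s) * (\sum_s wK K s).
Proof.
move=> K0; rewrite -subr_ge0.
have -> : (\sum_s sigmaX R s (symd S T) * wK K s) * (\sum_s wK K s)
   - (\sum_s sigmaX R s S * wK K s) * (\sum_s sigmaX R s T * wK K s)
  = \sum_u (1 - sigmaX R u T) *
     \sum_s sigmaX R s (symd S T) * wK (fun X => K X * (1 + sigmaX R u X)) s.
  under [RHS]eq_bigr do rewrite big_distrr/=.
  rewrite [RHS]exchange_big/= !big_distrlr/= -sumrB; apply: eq_bigr => s _.
  rewrite -sumrB (reindex_inj (inv_inj (cmulK s)))/=; apply: eq_bigr => u _.
  rewrite -sigmaX_mul sigmaX_cmul.
  have -> : wK (fun X => K X * (1 + sigmaX R u X)) s = wK K s * wK K (cmul s u).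
    rewrite /wK -expRD -big_split/=; congr expR; apply: eq_bigr => X _.
    by rewrite sigmaX_cmul; ring.
  by ring.
apply: sumr_ge0 => u _; apply: mulr_ge0.
  by case: (sigmaX_pm u T) => ->; lra.
by apply: griffiths1 => X; rewrite mulr_ge0//; case: (sigmaX_pm u X) => ->; lra.
Qed.

Definition ZK K : R := \sum_s wK K s.
Definition av K (f : cfg -> R) : R := (\sum_s f s * wK K s) / ZK K.

Lemma ZK_gt0 K : 0 < ZK K.
Proof.
rewrite /ZK (bigD1 [ffun=> true])//= ltr_pwDl ?wK_gt0// sumr_ge0// => s _.
exact/ltW/wK_gt0.
Qed.

Lemma avD K f g : av K (fun s => f s + g s) = av K f + av K g.
Proof. by rewrite /av -mulrDl -big_split/=; under eq_bigr do rewrite mulrDl. Qed.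

Lemma avZ K c f : av K (fun s => c * f s) = c * av K f.
Proof. by rewrite /av mulrA big_distrr/=; under eq_bigr do rewrite -mulrA. Qed.

Lemma av_sum K I (r : seq I) (f : I -> cfg -> R) :
  av K (fun s => \sum_(i <- r) f i s) = \sum_(i <- r) av K (f i).
Proof.
rewrite /av -big_distrl/=; congr (_ / _); rewrite exchange_big/=.
by apply: eq_bigr => s _; rewrite big_distrl.
Qed.

Lemma av_cst K c : av K (fun=> c) = c.
Proof. by rewrite /av -big_distrr/= mulfK// gt_eqF ?ZK_gt0. Qed.

Lemma eq_av K f g : f =1 g -> av K f = av K g.
Proof. by move=> /funext ->. Qed.

Lemma le_av K f g : (forall s, f s <= g s) -> av K f <= av K g.
Proof.
move=> fg; rewrite ler_pM2r ?invr_gt0 ?ZK_gt0//; apply: ler_sum => s _.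
by rewrite ler_pM2r ?wK_gt0.
Qed.

Definition ms K T : R := av K (fun s => sigmaX R s T).

Lemma ms_ge0 K T : (forall X, 0 <= K X) -> 0 <= ms K T.
Proof. by move=> K0; rewrite divr_ge0 ?griffiths1// ltW ?ZK_gt0. Qed.

Lemma ms_le1 K T : ms K T <= 1.
Proof. by rewrite -[leRHS](av_cst K); apply: le_av => s; case: (sigmaX_pm s T) => ->;
  lra. Qed.

Lemma gks2 K S T : (forall X, 0 <= K X) -> ms K S * ms K T <= ms K (symd S T).
Proof.
move=> K0; have := griffiths2 S T K0; rewrite -/(ZK K) => G.
rewrite /ms /av mulf_div ler_pdivrMr ?mulr_gt0 ?ZK_gt0//.
rewrite mulrA divfK ?gt_eqF ?ZK_gt0//.
Qed.

(** Raising one coupling by [c] multiplies each weight by [ch c + sh c * sigma_X0]. The new mean is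
    thus a ratio of two averages at the old couplings, and clearing the denominator leaves [sh c]
    times the second GKS inequality. *)
Lemma ms_mono K K' T X0 : (forall X, 0 <= K X) -> K X0 <= K' X0 ->
  (forall X, X != X0 -> K' X = K X) -> ms K T <= ms K' T.
Proof.
move=> K0 KK' KK.
pose c := K' X0 - K X0.
have w' s : wK K' s = wK K s * (ch c + sh c * sigmaX R s X0).
  rewrite -expR_sigmaX /wK -expRD; congr expR.
  rewrite (bigD1 X0)//= [in RHS](bigD1 X0)//=.
  under eq_bigr => X XX0 do rewrite KK//.
  by rewrite /c; ring.
have c0 : 0 <= c by rewrite subr_ge0.
have := sh_ge0 c0; have := sh_lt_ch c; have := ch_gt0 c => chc shch shc.
have := gks2 T X0 K0 => G.
have Z0 := ZK_gt0 K.
have E f : \sum_s f s * wK K' s = ZK K * (ch c * av K f + sh c * av K (fun s => f s *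
  sigmaX R s X0)).
  have Eav g : ZK K * av K g = \sum_s g s * wK K s by rewrite /av mulrC divfK ?gt_eqF.
  rewrite mulrDr [X in X + _]mulrCA [X in _ + X]mulrCA !Eav.
  rewrite !big_distrr/= -big_split/=; apply: eq_bigr => s _; rewrite w'; ring.
have Z' : ZK K' = ZK K * (ch c + sh c * ms K X0).
  have := E (fun=> 1); rewrite av_cst mulr1.
  under eq_bigr do rewrite mul1r.
  by rewrite -/(ZK K') => ->; congr (_ * (_ + _ * _)); apply: eq_av => s; rewrite mul1r.
have D0 : 0 < ch c + sh c * ms K X0 by rewrite ltr_wpDr// mulr_ge0// ms_ge0.
rewrite [leRHS]/ms /av E Z' -mulf_div mulfV ?gt_eqF// mul1r ler_pdivlMr//.
rewrite (@eq_av K (fun s => _ s T * _) (fun s => sigmaX R s (symd T X0))); last by move=>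
  s; rewrite sigmaX_mul.
rewrite -/(ms K T) -/(ms K (symd T X0)).
by rewrite mulrDr (mulrC _ (ch c)) lerD2l mulrCA ler_wpM2l.
Qed.

End Spin.

(** * Elementary inequalities on powers, [exp] and [ln] *)

Section Elementary.
Variable R : realType.

Lemma subX_le (x y : R) k : 0 <= y -> y <= x -> x <= 1 ->
  x ^+ k - y ^+ k <= k%:R * (x - y).
Proof.
move=> y0 yx x1; have x0 : 0 <= x by exact: le_trans yx.
rewrite subrXX mulrC ler_wpM2r ?subr_ge0//.
apply: (@le_trans _ _ (\sum_(i < k) 1)); last by rewrite sumr_const card_ord.
apply: ler_sum => i _; rewrite mulr_ile1 ?exprn_ge0 ?exprn_ile1//.
exact: le_trans x1.
Qed.

Lemma normr_subX_le (x y : R) k : `|x| <= 1 -> `|y| <= 1 ->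
  `|x ^+ k - y ^+ k| <= k%:R * `|x - y|.
Proof.
move=> x1 y1; rewrite subrXX normrM mulrC ler_wpM2r//.
apply: (le_trans (ler_norm_sum _ _ _)).
apply: (@le_trans _ _ (\sum_(i < k) 1)); last by rewrite sumr_const card_ord.
apply: ler_sum => i _; rewrite normrM !normrX mulr_ile1 ?exprn_ge0 ?exprn_ile1//.
Qed.

(** For [x >= -2] both sides of [1 + x / 2 <= exp (x / 2)] are nonnegative and may be squared. *)
Lemma expR_ge_quad (x : R) : -2 <= x -> 1 + x + x ^+ 2 / 4 <= expR x.
Proof.
move=> x2; have -> : expR x = expR (x / 2) ^+ 2.
  by rewrite expr2 -expRD; congr expR; lra.
have -> : 1 + x + x ^+ 2 / 4 = (1 + x / 2) ^+ 2 by field.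
rewrite lerXn2r ?nnegrE ?expR_ge0 ?expR_ge1Dx//; lra.
Qed.

(** The bound [1 + y <= exp y] at [y = - ln (1 + u)] gives [ln (1 + u) >= 1 - 1 / (1 + u)], which
    exceeds [u / 2] on [0, 1]. *)
Lemma ln1D_ge (u : R) : 0 <= u -> u <= 1 -> u / 2 <= ln (1 + u).
Proof.
move=> u0 u1; have u1p : 0 < 1 + u by lra.
have h := expR_ge1Dx (- ln (1 + u)).
rewrite expRN lnK ?posrE// in h.
have : u / 2 <= 1 - (1 + u)^-1; last lra.
rewrite -subr_ge0.
have -> : 1 - (1 + u)^-1 - u / 2 = u * (1 - u) / (2 * (1 + u)) by field; lra.
by rewrite divr_ge0 ?mulr_ge0 ?subr_ge0//; lra.
Qed.

Lemma normr_sqr_dist_le1 (x y : R) : 0 <= x <= 1 -> 0 <= y <= 1 -> `|(x - y) ^+ 2| <= 1.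
Proof.
move=> x01 y01; rewrite ger0_norm ?sqr_ge0// -(real_normK (num_real (x - y))) exprn_ile1//.
by rewrite ler_norml; lra.
Qed.

(* [q] and [r] are slopes at [h] of the convex functions [P] and [p], sampled at
   [h + del], [h] and [h - del]. *)
Lemma sqr_dev_le (del q r rp rm Pp P0 Pm pp p0 pm : R) (Del := rp - rm) : 0 < del ->
  del * q <= Pp - P0 -> - del * q <= Pm - P0 ->
  del * r <= pp - p0 -> pp - p0 <= del * rp -> - del * r <= pm - p0 -> pm - p0 <= - del *
    rm ->
  0 <= Del -> Del <= 1 ->
  (q - r) ^+ 2 <=
    6 / del ^+ 2 * ((Pp - pp) ^+ 2 + ((P0 - p0) ^+ 2 + (Pm - pm) ^+ 2)) + 2 * Del.
Proof.
move=> del0 t1 t3 s1 s2 s3 s4 Del0 Del1.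
set a := Pp - pp; set b := P0 - p0; set c := Pm - pm.
set x := q - r.
have up : del * x <= a - b + del * Del by rewrite /x /a /b /Del; lra.
have lo : - (del * x) <= c - b + del * Del by rewrite /x /c /b /Del; lra.
pose y := `|a| + `|b| + `|c|.
have y0 : 0 <= y by rewrite !addr_ge0.
have xy : `|del * x| <= y + del * Del.
  rewrite ler_norml; apply/andP; split.
    rewrite lerNl (le_trans lo)// lerD2r /y.
    have := ler_norm c; have := ler_norm (- b); rewrite normrN; have := normr_ge0 a; lra.
  rewrite (le_trans up)// lerD2r /y.
  have := ler_norm a; have := ler_norm (- b); rewrite normrN; have := normr_ge0 c; lra.
have xy2 : del ^+ 2 * x ^+ 2 <= (y + del * Del) ^+ 2.
  rewrite -exprMn -(real_normK (num_real (del * x))) lerXn2r// nnegrE.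
  by rewrite addr_ge0// mulr_ge0// ltW.
have d2 : 0 < del ^+ 2 by rewrite exprn_gt0.
have yabc : y ^+ 2 <= 3 * (a ^+ 2 + (b ^+ 2 + c ^+ 2)).
  rewrite -(real_normK (num_real a)) -(real_normK (num_real b)) -(real_normK (num_real
    c)) /y.
  move: `|a| `|b| `|c| => a1 b1 c1; rewrite -subr_ge0.
  have -> : 3 * (a1 ^+ 2 + (b1 ^+ 2 + c1 ^+ 2)) - (a1 + b1 + c1) ^+ 2 =
    (a1 - b1) ^+ 2 + ((b1 - c1) ^+ 2 + (a1 - c1) ^+ 2) by ring.
  by rewrite !addr_ge0 ?sqr_ge0.
have sq : (y + del * Del) ^+ 2 <= 2 * y ^+ 2 + 2 * (del ^+ 2 * Del ^+ 2).
  rewrite -subr_ge0.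
  have -> : 2 * y ^+ 2 + 2 * (del ^+ 2 * Del ^+ 2) - (y + del * Del) ^+ 2 = (y - del *
    Del) ^+ 2 by ring.
  exact: sqr_ge0.
have DD : Del ^+ 2 <= Del by rewrite expr2 ler_piMr.
have DD' : del ^+ 2 * Del ^+ 2 <= del ^+ 2 * Del by rewrite ler_pM2l.
rewrite -(ler_pM2l d2) mulrDr.
have -> : del ^+ 2 * (6 / del ^+ 2 * (a ^+ 2 + (b ^+ 2 + c ^+ 2))) = 6 * (a ^+ 2 + (b ^+
  2 + c ^+ 2)).
  by field; rewrite gt_eqF.
lra.
Qed.

End Elementary.

(** * Magnetisation and pressure under a uniform field *)

Section Magnetisation.
Variables (R : realType) (n : nat).
Implicit Types (K : {set 'I_n} -> R) (s : config n).

Definition Sp s : R := \sum_(i < n) spin R (s i).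

(** A uniform field is a coupling on every singleton. The sum of indicators selects the singletons
    without having to extract an element from [X]. *)
Definition addh K (h : R) : {set 'I_n} -> R :=
  fun X => K X + \sum_(i < n) (X == [set i])%:R * h.

Definition qm K : R := n%:R^-1 * \sum_(i < n) ms K [set i].

(** The thermal variance of [Q_1], written with truncated two-point functions because GKS compares
    the overlaps with it term by term; [vmE] recovers the usual form. *)
Definition vm K : R := n%:R^-1 ^+ 2 *
  \sum_(i < n) \sum_(j < n) (ms K (symd [set i] [set j]) - ms K [set i] * ms K [set j]).

Lemma sigmaX1 s i : sigmaX R s [set i] = spin R (s i).
Proof. by rewrite /sigmaX big_set1. Qed.

Lemma sum_addh K (g : 'I_n -> R) s :
  \sum_X (K X + \sum_(i < n) (X == [set i])%:R * g i) * sigmaX R s X =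
  \sum_X K X * sigmaX R s X + \sum_(i < n) g i * spin R (s i).
Proof.
under eq_bigr do rewrite mulrDl.
rewrite big_split/=; congr (_ + _).
under eq_bigr do rewrite big_distrl/=.
rewrite exchange_big/=; apply: eq_bigr => i _.
rewrite (bigD1 [set i])//= eqxx mul1r sigmaX1 big1 ?addr0// => X /negbTE ->.
by rewrite !mul0r.
Qed.

Lemma wK_addh K h s : wK (addh K h) s = wK K s * expR (h * Sp s).
Proof. by rewrite /wK sum_addh expRD -mulr_sumr. Qed.

Lemma ZK_addh K h : ZK (addh K h) = ZK K * av K (fun s => expR (h * Sp s)).
Proof.
rewrite /av mulrC divfK ?gt_eqF ?ZK_gt0//; apply: eq_bigr => s _.
by rewrite wK_addh mulrC.
Qed.

Lemma av_Sp K : av K Sp = \sum_(i < n) ms K [set i].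
Proof.
rewrite /Sp av_sum; apply: eq_bigr => i _; apply: eq_av => s.
by rewrite sigmaX1.
Qed.

Lemma addh_ge0 K h : 0 <= h -> (forall X, 0 <= K X) -> forall X, 0 <= addh K h X.
Proof.
move=> h0 K0 X; rewrite addr_ge0// sumr_ge0// => i _.
by rewrite mulr_ge0.
Qed.

Lemma addhK K h h' : addh (addh K h) h' = addh K (h + h').
Proof.
apply/funext => X; rewrite /addh -addrA -big_split/=; congr (_ + _).
by apply: eq_bigr => i _; rewrite mulrDr.
Qed.

(** Jensen's inequality for [exp]: the ratio of partition functions is the average of [exp (h Sp)],
    and [exp] lies above its tangent at [h <Sp>]. The sign of [h] is free, which later yields the
    upper bound as well. *)
Lemma ln_ZK_addh_ge K h : h * av K Sp <= ln (ZK (addh K h)) - ln (ZK K).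
Proof.
rewrite ZK_addh; set m := av K Sp.
have A0 : expR (h * m) <= av K (fun s => expR (h * Sp s)).
  have -> : expR (h * m) = av K (fun s => expR (h * m) * (1 - h * m) + expR (h * m) * h *
    Sp s).
    by rewrite avD av_cst avZ -/m; ring.
  apply: le_av => s.
  have -> : h * Sp s = h * m + (h * Sp s - h * m) by ring.
  rewrite expRD.
  have := ler_wpM2l (expR_ge0 (h * m)) (expR_ge1Dx (h * Sp s - h * m)).
  by apply: le_trans; rewrite le_eqVlt; apply/orP; left; apply/eqP; ring.
rewrite lnM ?posrE ?ZK_gt0//; last exact: lt_le_trans (expR_gt0 _) A0.
rewrite addrAC subrr add0r -[leLHS]expRK ler_ln// ?posrE ?expR_gt0//.
exact: lt_le_trans (expR_gt0 _) A0.
Qed.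

Lemma addh0 K : addh K 0 = K.
Proof.
apply/funext => X; rewrite /addh big1 ?addr0// => i _; exact: mulr0.
Qed.

Hypothesis n0 : (0 < n)%N.
Let n0R : (0 : R) < n%:R. Proof. by rewrite ltr0n. Qed.

Lemma av_SpE K : av K Sp = n%:R * qm K.
Proof. by rewrite av_Sp /qm mulrA mulfV ?gt_eqF// mul1r. Qed.

Lemma qm_mean K : qm K = av K (fun s => n%:R^-1 * Sp s).
Proof. by rewrite avZ av_Sp. Qed.

Definition Pm K : R := n%:R^-1 * ln (ZK K).

Lemma Pm_addh_ge K h : h * qm K <= Pm (addh K h) - Pm K.
Proof.
have := ln_ZK_addh_ge K h; rewrite av_SpE /Pm -mulrBr mulrCA => H.
by rewrite -(ler_pM2l n0R) (mulrA n%:R n%:R^-1) mulfV ?gt_eqF// mul1r.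
Qed.

(** The lower bound, applied at the shifted couplings with the opposite increment. *)
Lemma Pm_addh_le K h : Pm (addh K h) - Pm K <= h * qm (addh K h).
Proof.
have := Pm_addh_ge (addh K h) (- h); rewrite addhK subrr addh0 mulNr; lra.
Qed.

(** The two slope bounds enclose the same pressure increment: this is convexity, with no sign
    condition on the couplings. *)
Lemma qm_addh_mono K h : 0 <= h -> qm K <= qm (addh K h).
Proof.
rewrite le_eqVlt => /predU1P[<-|h0]; first by rewrite addh0.
have := Pm_addh_ge K h; have := Pm_addh_le K h => A B.
by rewrite -(ler_pM2l h0); exact: le_trans B A.
Qed.

Lemma qm_ge0 K : (forall X, 0 <= K X) -> 0 <= qm K.
Proof. by move=> K0; rewrite mulr_ge0 ?invr_ge0// sumr_ge0// => i _; exact: ms_ge0. Qed.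

Lemma mean_le1 (f : 'I_n -> R) : (forall i, f i <= 1) -> n%:R^-1 * \sum_(i < n) f i <= 1.
Proof.
move=> f1; rewrite mulrC ler_pdivrMr// mul1r.
apply: (@le_trans _ _ (\sum_(i < n) 1)); first by apply: ler_sum.
by rewrite sumr_const card_ord.
Qed.

Lemma qm_le1 K : qm K <= 1.
Proof. by apply: mean_le1 => i; exact: ms_le1. Qed.

Lemma Sp_bound s : -1 <= n%:R^-1 * Sp s <= 1.
Proof.
apply/andP; split.
  rewrite lerNl -mulrN /Sp -sumrN; apply: mean_le1 => i.
  by case: (s i); rewrite /spin; lra.
by apply: mean_le1 => i; case: (s i); rewrite /spin; lra.
Qed.

Lemma vmE K : vm K = av K (fun s => (n%:R^-1 * Sp s - qm K) ^+ 2).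
Proof.
have -> : av K (fun s => (n%:R^-1 * Sp s - qm K) ^+ 2) =
   n%:R^-1 ^+ 2 * av K (fun s => Sp s * Sp s) - qm K ^+ 2.
  rewrite (@eq_av _ _ _ _ (fun s => n%:R^-1 ^+ 2 * (Sp s * Sp s) +
     (- 2 * qm K * (n%:R^-1 * Sp s) + qm K ^+ 2))); last by move=> s; ring.
  by rewrite avD avZ avD avZ -qm_mean av_cst; ring.
rewrite /vm /qm exprMn -mulrBr; congr (_ * _).
rewrite expr2 big_distrlr/= -sumrB av_sum ||
  (under eq_bigr do rewrite sumrB; rewrite sumrB; congr (_ - _);
    last by rewrite expr2 big_distrlr).
rewrite (@eq_av _ _ _ (fun s => Sp s * Sp s) (fun s => \sum_(i < n) \sum_(j < n) sigmaX R
  s (symd [set i] [set j]))).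
  by rewrite av_sum; apply: eq_bigr => i _; rewrite av_sum.
move=> s; rewrite /Sp big_distrlr/=; apply: eq_bigr => i _; apply: eq_bigr => j _.
by rewrite -sigmaX_mul !sigmaX1.
Qed.

Lemma vm_ge0 K : 0 <= vm K.
Proof. by rewrite vmE -[leLHS](av_cst K); apply: le_av => s; exact: sqr_ge0. Qed.

Lemma qm_itv K : -1 <= qm K <= 1.
Proof.
rewrite qm_le1 andbT qm_mean -[leLHS](av_cst K); apply: le_av => s.
by case/andP: (Sp_bound s).
Qed.

(** Let [y = Q_1 - <Q_1>], which lies in [-2, 2]. A field increment [1/n] changes [ln Z] by exactly
    [<Q_1> + ln <exp y>], and by convexity by at most the new [<Q_1>]. Since [<y> = 0], the
    quadratic bound on [exp] gives [<exp y> >= 1 + vm / 4]. As [vm <= 4],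
    [ln (1 + vm / 4) >= vm / 8], whence the 8. *)
Lemma vm_le K : vm K <= 8 * (qm (addh K n%:R^-1) - qm K).
Proof.
pose y s := n%:R^-1 * Sp s - qm K.
have y2 s : -2 <= y s <= 2.
  by have /andP[] := Sp_bound s; have /andP[] := qm_itv K; rewrite /y; lra.
have v4 : vm K <= 4.
  rewrite vmE -[leRHS](av_cst K); apply: le_av => s; rewrite -/(y s).
  have /andP[a b] := y2 s; rewrite -subr_ge0.
  have -> : 4 - y s ^+ 2 = (2 - y s) * (y s - -2) by ring.
  by rewrite mulr_ge0// subr_ge0.
have v0 := vm_ge0 K.
have y0 : av K y = 0 by rewrite /y avD av_cst -qm_mean subrr.
have A : 1 + vm K / 4 <= av K (fun s => expR (y s)).
  have -> : 1 + vm K / 4 = av K (fun s => 1 + (y s + 4^-1 * (y s) ^+ 2)).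
    by rewrite avD av_cst avD y0 avZ -vmE; ring.
  apply: le_av => s; have /andP[a b] := y2 s.
  by have := expR_ge_quad a; lra.
have B : ln (ZK (addh K n%:R^-1)) - ln (ZK K) = qm K + ln (av K (fun s => expR (y s))).
  have -> : ZK (addh K n%:R^-1) = ZK K * (expR (qm K) * av K (fun s => expR (y s))).
    rewrite ZK_addh; congr (_ * _); rewrite -avZ; apply: eq_av => s.
    by rewrite -expRD /y; congr expR; ring.
  have p : 0 < av K (fun s => expR (y s)) by apply: lt_le_trans A; lra.
  rewrite lnM; [|by rewrite posrE ZK_gt0|by rewrite posrE mulr_gt0 ?expR_gt0].
  rewrite lnM ?expRK; [|by rewrite posrE expR_gt0|by rewrite posrE].
  by ring.
have C : ln (ZK (addh K n%:R^-1)) - ln (ZK K) <= qm (addh K n%:R^-1).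
  have := Pm_addh_le K n%:R^-1; rewrite /Pm -mulrBr.
  by rewrite ler_pM2l ?invr_gt0.
have D : vm K / 4 / 2 <= ln (1 + vm K / 4) by apply: ln1D_ge; lra.
have E : ln (1 + vm K / 4) <= ln (av K (fun s => expR (y s))).
  by rewrite ler_ln// ?posrE; [lra|apply: lt_le_trans A; lra].
lra.
Qed.

End Magnetisation.

(** * Replicas and multi-overlaps *)

Section Replicas.
Variables (R : realType) (n : nat).
Implicit Types (K : {set 'I_n} -> R) (s : config n).

(** The site variables [t] are real, so that both Poisson counts and absolute values of arbitrary
    reals can be substituted. *)
Definition fields (J : {set 'I_n} -> R) (t : 'I_n -> R) (h1 : R) : {set 'I_n} -> R :=
  fun X => J X + \sum_(i < n) (X == [set i])%:R * (h1 * t i).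

Lemma gweightE J (tau : 'I_n -> nat) h0 h1 s :
  gweight J tau h0 h1 s = wK (addh (fields J (fun i => (tau i)%:R) h1) h0) s.
Proof.
rewrite wK_addh /wK sum_addh -expRD /gweight /ham; congr expR.
rewrite !opprB !opprK /Sp mulr_sumr.
under eq_bigr do rewrite mulrA.
ring.
Qed.

Lemma ZpartE J (tau : 'I_n -> nat) h0 h1 :
  Zpart J tau h0 h1 = ZK (addh (fields J (fun i => (tau i)%:R) h1) h0).
Proof. by apply: eq_bigr => s _; rewrite gweightE. Qed.

Lemma PnE J (tau : 'I_n -> nat) h0 h1 :
  Pn J tau h0 h1 = Pm (addh (fields J (fun i => (tau i)%:R) h1) h0).
Proof. by rewrite /Pn ZpartE. Qed.

Lemma fields_ge0 J t h1 : (forall X, 0 <= J X) -> (forall i, 0 <= t i) -> 0 <= h1 ->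
  forall X, 0 <= fields J t h1 X.
Proof. by move=> J0 t0 h0 X; rewrite addr_ge0// sumr_ge0// => i _; rewrite !mulr_ge0. Qed.

Section gibbs.
Variables (J : {set 'I_n} -> R) (tau : 'I_n -> nat) (h0 h1 : R) (k : nat).
Local Notation G := (@gibbs R n J tau h0 h1 k).
Local Notation K := (addh (fields J (fun i => (tau i)%:R) h1) h0).
Implicit Types f g : {ffun 'I_k -> config n} -> R.

Lemma gibbsD f g : G (fun ss => f ss + g ss) = G f + G g.
Proof. by rewrite /gibbs -big_split/=; apply: eq_bigr => ss _; rewrite -mulrDl -mulrDr. Qed.

Lemma gibbsZ c f : G (fun ss => c * f ss) = c * G f.
Proof. by rewrite /gibbs big_distrr/=; apply: eq_bigr => ss _; rewrite mulrCA !mulrA. Qed.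

Lemma gibbs_sum I (r : seq I) (f : I -> {ffun 'I_k -> config n} -> R) :
  G (fun ss => \sum_(i <- r) f i ss) = \sum_(i <- r) G (f i).
Proof.
rewrite /gibbs exchange_big/=; apply: eq_bigr => ss _.
by rewrite big_distrr big_distrl.
Qed.

Lemma eq_gibbs f g : f =1 g -> G f = G g.
Proof. by move=> /funext ->. Qed.

Lemma le_gibbs f g : (forall ss, f ss <= g ss) -> G f <= G g.
Proof.
move=> fg; apply: ler_sum => ss _.
apply: ler_wpM2r; first by rewrite invr_ge0 exprn_ge0// ZpartE ltW// ZK_gt0.
apply: ler_wpM2l => //; apply: prodr_ge0 => j _.
by rewrite gweightE ltW// wK_gt0.
Qed.

Lemma gibbs_prod (g : config n -> R) : G (fun ss => \prod_(j < k) g (ss j)) = av K g ^+ k.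
Proof.
rewrite /gibbs ZpartE -big_distrl/= /av expr_div_n; congr (_ / _).
transitivity (\prod_(j < k) \sum_s g s * wK K s); last by rewrite prodr_const card_ord.
rewrite bigA_distr_bigA/=; apply: eq_bigr => ss _.
by rewrite -big_split/=; apply: eq_bigr => j _; rewrite gweightE mulrC.
Qed.

Lemma gibbs_cst c : G (fun=> c) = c.
Proof.
rewrite -[RHS]mulr1 -[X in _ = c * X](expr1n _ k) -(av_cst K 1) -gibbs_prod -gibbsZ.
by apply: eq_gibbs => ss; rewrite big1 ?mulr1.
Qed.

End gibbs.

Definition qk k K : R := n%:R^-1 * \sum_(i < n) ms K [set i] ^+ k.

Lemma gibbs_Qk J tau h0 h1 k :
  gibbs J tau h0 h1 (@Qk R n k) = qk k (addh (fields J (fun i => (tau i)%:R) h1) h0).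
Proof.
rewrite gibbsZ gibbs_sum; congr (_ * _); apply: eq_bigr => i _.
rewrite (gibbs_prod J tau h0 h1 k (fun s => spin R (s i))); congr (_ ^+ _).
by apply: eq_av => s; rewrite sigmaX1.
Qed.

Lemma gibbs_Qk2 J tau h0 h1 k (K := addh (fields J (fun i => (tau i)%:R) h1) h0) :
  gibbs J tau h0 h1 (fun ss => @Qk R n k ss ^+ 2) =
  n%:R^-1 ^+ 2 * \sum_(i < n) \sum_(j < n) ms K (symd [set i] [set j]) ^+ k.
Proof.
rewrite (@eq_gibbs _ _ _ _ _ _ (fun ss => n%:R^-1 ^+ 2 *
   \sum_(i < n) \sum_(j < n) \prod_(l < k) sigmaX R (ss l) (symd [set i] [set j]))); last
     first.
  move=> ss; rewrite /Qk exprMn; congr (_ * _); rewrite expr2 big_distrlr/=.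
  apply: eq_bigr => i _; apply: eq_bigr => j _; rewrite -big_split/=.
  by apply: eq_bigr => l _; rewrite -sigmaX_mul !sigmaX1.
rewrite gibbsZ gibbs_sum; congr (_ * _); apply: eq_bigr => i _.
rewrite gibbs_sum; apply: eq_bigr => j _.
by rewrite (gibbs_prod J tau h0 h1 k (fun s => sigmaX R s (symd [set i] [set j]))).
Qed.

Hypothesis n0 : (0 < n)%N.

Lemma Qk_abs_le1 k ss : `|@Qk R n k ss| <= 1.
Proof.
rewrite normrM gtr0_norm ?invr_gt0 ?ltr0n//.
apply: (@le_trans _ _ (n%:R^-1 * \sum_(i < n) 1)).
  rewrite ler_wpM2l// (le_trans (ler_norm_sum _ _ _))//; apply: ler_sum => i _.
  rewrite normr_prod prodr_ile1// => j _; rewrite normr_ge0/=.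
  by case: (ss j i); rewrite /spin ?normrN normr1.
by rewrite sumr_const card_ord mulVf// pnatr_eq0 -lt0n.
Qed.

Lemma qk_ge0 k K : (forall X, 0 <= K X) -> 0 <= qk k K.
Proof.
by move=> K0; rewrite mulr_ge0// sumr_ge0// => i _; rewrite exprn_ge0// ms_ge0.
Qed.

Lemma qk_le1 k K : (forall X, 0 <= K X) -> qk k K <= 1.
Proof. by move=> K0; apply: mean_le1 => // i; rewrite exprn_ile1 ?ms_ge0 ?ms_le1. Qed.

(** For each pair of sites, [a = <sigma_i sigma_j>] and [b = <sigma_i> <sigma_j>] satisfy
    [0 <= b <= a <= 1] by the two GKS inequalities, hence [a^k - b^k <= k (a - b)]. *)
Lemma gibbs_Qk_var J tau h0 h1 k (K := addh (fields J (fun i => (tau i)%:R) h1) h0) :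
  (forall X, 0 <= K X) ->
  gibbs J tau h0 h1 (fun ss => @Qk R n k ss ^+ 2) - qk k K ^+ 2 <= k%:R * vm K.
Proof.
move=> K0; rewrite gibbs_Qk2 -/K /qk exprMn -mulrBr /vm mulrCA.
rewrite ler_wpM2l ?sqr_ge0// expr2 big_distrlr/= -sumrB big_distrr/=.
apply: ler_sum => i _; rewrite -sumrB big_distrr/=; apply: ler_sum => j _.
rewrite -exprMn; apply: subX_le; [by rewrite mulr_ge0 ?ms_ge0|exact: gks2|exact: ms_le1].
Qed.

(** The power [p] costs a factor [p] because [Q_k] and [m] lie in [-1, 1]. After the quadratic bound
    on the absolute value, the mean square deviation from [m] splits into the thermal variance and
    [(<Q_k> - m)^2]. *)
Lemma gibbs_Qk_dev J tau h0 h1 k p m eps (K := addh (fields J (fun i => (tau i)%:R) h1)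
  h0) :
  (forall X, 0 <= K X) -> `|m| <= 1 -> 0 < eps ->
  gibbs J tau h0 h1 (fun ss => `|@Qk R n k ss ^+ p - m ^+ p|) <=
  p%:R * (eps / 2 + (k%:R * vm K + (qk k K - m) ^+ 2) / (2 * eps)).
Proof.
move=> K0 m1 e0.
have /le_trans : gibbs J tau h0 h1 (fun ss => `|@Qk R n k ss ^+ p - m ^+ p|) <=
  gibbs J tau h0 h1 (fun ss => p%:R * (eps / 2 + (2 * eps)^-1 * (@Qk R n k ss - m) ^+ 2)).
  apply: le_gibbs => ss; apply: (le_trans (normr_subX_le p (Qk_abs_le1 ss) m1)).
  rewrite ler_wpM2l// -real_normK ?num_real//; set x := `|_|.
  rewrite -subr_ge0.
  have -> : eps / 2 + (2 * eps)^-1 * x ^+ 2 - x = (x - eps) ^+ 2 / (2 * eps).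
    by field; lra.
  by rewrite divr_ge0 ?sqr_ge0//; lra.
apply; rewrite gibbsZ ler_wpM2l// gibbsD gibbs_cst lerD2l gibbsZ mulrC.
apply: ler_wpM2r; first by rewrite invr_ge0; lra.
rewrite (@eq_gibbs _ _ _ _ _ _ (fun ss => @Qk R n k ss ^+ 2 + (- 2 * m * @Qk R n k ss + m
  ^+ 2))); last first.
  by move=> ss; ring.
rewrite gibbsD gibbsD gibbsZ gibbs_cst gibbs_Qk -/K.
have := @gibbs_Qk_var J tau h0 h1 k K0; rewrite -/K; lra.
Qed.

Lemma gibbs_ge0 J tau h0 h1 k (f : {ffun 'I_k -> config n} -> R) :
  (forall ss, 0 <= f ss) -> 0 <= gibbs J tau h0 h1 f.
Proof. by move=> f0; rewrite -[leLHS](gibbs_cst J tau h0 h1 k); exact: le_gibbs. Qed.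

(* [k x - x ^ k] is nondecreasing on [0, 1]. *)
Lemma qk_mono k K K' X0 : (forall X, 0 <= K X) -> K X0 <= K' X0 ->
  (forall X, X != X0 -> K' X = K X) ->
  qk k K <= qk k K' /\ k%:R * qm K - qk k K <= k%:R * qm K' - qk k K'.
Proof.
move=> K0 KK' KX; have K0' X : 0 <= K' X.
  by have [->|/KX ->] := eqVneq X X0; rewrite ?(le_trans (K0 _) KK').
have M i := ms_mono [set i] K0 KK' KX.
split.
  rewrite ler_wpM2l// ; apply: ler_sum => i _.
  by rewrite lerXn2r ?nnegrE ?ms_ge0.
rewrite /qm /qk !(mulrCA k%:R) -!mulrBr ler_wpM2l// !mulr_sumr -!sumrB.
apply: ler_sum => i _.
have := subX_le k (ms_ge0 [set i] K0) (M i) (ms_le1 K' [set i]); lra.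
Qed.

End Replicas.

(** * Laws of independent families and Harris' inequality *)

Section Law.
Local Open Scope classical_set_scope.
Local Open Scope ring_scope.
Variable R : realType.

(** Measurability is tested on all measurable families of coordinates, so the function space
    [I -> R] needs no sigma-algebra of its own. *)
Definition coord_measurable (I : finType) (H : (I -> R) -> R) : Prop :=
  forall d (T : measurableType d) (Y : I -> T -> R),
    (forall i, measurable_fun setT (Y i)) -> measurable_fun setT (fun w => H (Y ^~ w)).

Definition rect (I : finType) (T : Type) (Y : I -> T -> R) (B : I -> set R) : set T :=
  [set w | forall i, B i (Y i w)].

Lemma rectE (I : finType) (T : Type) (Y : I -> T -> R) (B : I -> set R) :
  rect Y B = \big[setI/setT]_(i : I) (Y i @^-1` B i).
Proof.
apply/seteqP; split => w /=.
  by move=> h; apply: (big_ind (fun A : set T => A w)) => //= A A' ? ?; split.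
by move=> + i; rewrite (bigD1 i)//= => -[].
Qed.

Lemma measurable_rect (I : finType) d (T : measurableType d) (Y : I -> T -> R) B :
  (forall i, measurable_fun setT (Y i)) -> (forall i, measurable (B i)) ->
  measurable (rect Y B).
Proof.
move=> mY mB; rewrite rectE; apply: bigsetI_measurable => i _.
by rewrite -[_ @^-1` _]setTI; exact: mY.
Qed.

(** Boxes are stable under intersection and generate the product sigma-algebra, so two laws agreeing
    on boxes are equal and integrate [H] alike. *)
Lemma eq_law_integral (I : finType) d1 d2 (T1 : measurableType d1) (T2 : measurableType d2)
  (P1 : probability T1 R) (P2 : probability T2 R) (Y1 : I -> T1 -> R) (Y2 : I -> T2 -> R) :
  (forall i, measurable_fun setT (Y1 i)) -> (forall i, measurable_fun setT (Y2 i)) ->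
  (forall B : I -> set R, (forall i, measurable (B i)) -> P1 (rect Y1 B) = P2 (rect Y2
    B)) ->
  forall H, coord_measurable H -> (forall x, 0 <= H x) ->
  (\int[P1]_w (H (Y1 ^~ w))%:E = \int[P2]_w (H (Y2 ^~ w))%:E)%E.
Proof.
move=> mY1 mY2 Y12 H mH H0.
(* Enumerating [I] turns the family into an [N]-tuple, a type carrying the product sigma-algebra. *)
pose N := #|I|.
pose phi T (Y : I -> T -> R) (w : T) : N.-tuple R := [tuple Y (enum_val j) w | j < N].
have mphi d (T : measurableType d) (Y : I -> T -> R) :
    (forall i, measurable_fun setT (Y i)) -> measurable_fun setT (phi T Y).
  move=> mY; apply/measurable_fun_tnthP => j.
  rewrite (_ : _ \o _ = Y (enum_val j)); first exact: mY.
  by apply/funext => w /=; rewrite tnth_mktuple.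
pose Z (i : I) (t : N.-tuple R) := tnth t (enum_rank i).
have mZ i : measurable_fun setT (Z i) by exact: measurable_tnth.
have HZ T (Y : I -> T -> R) w : H (Z ^~ (phi T Y w)) = H (Y ^~ w).
  by congr H; apply/funext => i; rewrite /Z tnth_mktuple enum_rankK.
have push d (T : measurableType d) (P : probability T R) (Y : I -> T -> R)
    (mY : forall i, measurable_fun setT (Y i)) :
    (\int[P]_w (H (Y ^~ w))%:E = \int[pushforward P (phi T Y)]_t (H (Z ^~ t))%:E)%E.
  rewrite (ge0_integral_pushforward (mphi _ _ _ mY))//=.
  - by rewrite preimage_setT; apply: eq_integral => w _ /=; rewrite HZ.
  - exact/measurable_EFinP/mH.
  - by move=> t _; rewrite lee_fin.
rewrite (push _ _ P1 _ mY1) (push _ _ P2 _ mY2).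
have m1 := mphi _ _ _ mY1; have m2 := mphi _ _ _ mY2.
pose M1 : {mfun T1 >-> N.-tuple R} := HB.pack (phi T1 Y1) (isMeasurableFun.Build _ _ _ _
  _ m1).
pose M2 : {mfun T2 >-> N.-tuple R} := HB.pack (phi T2 Y2) (isMeasurableFun.Build _ _ _ _
  _ m2).
change (\int[pushforward P1 M1]_t (H (Z ^~ t))%:E = \int[pushforward P2 M2]_t (H (Z ^~
  t))%:E)%E.
apply: eq_measure_integral => A mA _.
pose G := [set rect Z B | B in [set B : I -> set R | forall i, measurable (B i)]].
apply: (@g_sigma_algebra_measure_unique _ _ _ G _ (fun=> setT)) => //.
- by move=> _ [B mB <-]; exact: measurable_rect.
- by move=> _; exists (fun=> setT) => //; apply/seteqP; split.
- by rewrite bigcup_const.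
- move=> _ _ [B mB <-] [C mC <-]; exists (fun i => B i `&` C i).
    by move=> i; exact: measurableI.
  apply/seteqP; split => t /=; first by move=> h; split => i; case: (h i).
  by move=> [h h'] i; split.
- move=> _ [B mB <-]; rewrite /pushforward.
  have E T (Y : I -> T -> R) : phi T Y @^-1` rect Z B = rect Y B.
    apply/seteqP; split => w /= h i; have := h i; rewrite /Z tnth_mktuple enum_rankK//.
  by have := Y12 B mB; rewrite -(E _ Y1) -(E _ Y2).
- by move=> k; rewrite (le_lt_trans (probability_le1 P1 _)) ?ltry// -[X in measurable
  X]setTI;
    exact: (measurable_funP M1).
(* The sigma-algebra of tuples is generated by preimages under single coordinates; each one is a box
   whose other sides are full. *)
- move: A mA; apply: smallest_sub; first exact: smallest_sigma_algebra.
  rewrite -bigcup_seq => A /= [j _] /= [B mB <-].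
  apply: sub_sigma_algebra; exists (fun i => if enum_rank i == j then B else setT).
    by move=> i; case: ifP.
  apply/seteqP; split => t /=.
    by move=> /(_ (enum_val j)); rewrite /Z enum_valK eqxx.
  by move=> [_ h] i; case: ifPn => // /eqP ij; rewrite /Z ij.
Qed.

End Law.

Section Bounded.
Local Open Scope classical_set_scope.
Local Open Scope ring_scope.
Variables (R : realType) (d : measure_display) (T : measurableType d) (P : probability T R).

Lemma bounded_integrable (f : T -> R) (c : R) :
  measurable_fun setT f -> (forall w, `|f w| <= c) -> P.-integrable setT (EFin \o f).
Proof.
move=> mf fc; apply: measurable_bounded_integrable => //.
  by rewrite (le_lt_trans (probability_le1 P _))// ltry.
exists c; split; first exact: num_real.
by move=> M cM w _; exact: le_trans (fc w) (ltW cM).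
Qed.

Lemma Rintegral_prob_cst (c : R) : \int[P]_w c = c.
Proof. by rewrite Rintegral_cst// [X in fine X](_ : _ = 1%E) ?mulr1//; exact:
  probability_setT. Qed.

End Bounded.

(** * Correlation of monotone functions of independent coordinates *)

Section Harris.
Local Open Scope classical_set_scope.
Local Open Scope ring_scope.
Variables (R : realType) (I : finType) (d : measure_display) (T : measurableType d).
Variables (P : probability T R) (X : I -> T -> R).
Hypothesis mX : forall i, measurable_fun setT (X i).
Hypothesis indepX : forall B : I -> set R, (forall i, measurable (B i)) ->
  P (rect X B) = (\prod_i fine (P (X i @^-1` B i)))%:E.

(** Two copies of every coordinate, indexed by [I * bool]; [sel] tells from which factor of [T * T]
    each copy is read. *)
Definition mix (sel : I * bool -> bool) (ib : I * bool) (z : T * T) : R :=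
  X ib.1 (if sel ib then z.2 else z.1).

Lemma measurable_mix sel ib : measurable_fun setT (mix sel ib).
Proof. by rewrite /mix; case: (sel ib); apply: measurableT_comp. Qed.

(** Exchanging the two copies at the coordinates chosen by [phi] only permutes the two factors
    belonging to such a coordinate. The right-hand side is free of [phi], so the law of the doubled
    family is invariant under these exchanges. *)
Lemma mix_rect (phi : I -> bool) (B : I * bool -> set R) : (forall ib, measurable (B ib)) ->
  (P \x P)%E (rect (mix (fun ib => ib.2 (+) phi ib.1)) B) =
  (\prod_i (fine (P (X i @^-1` B (i, false))) * fine (P (X i @^-1` B (i, true)))))%:E.
Proof.
move=> mB.
have -> : rect (mix (fun ib => ib.2 (+) phi ib.1)) B =
   rect X (fun i => B (i, phi i)) `*` rect X (fun i => B (i, ~~ phi i)).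
  apply/seteqP; split => -[w w'] /=.
    move=> h; split => i.
      by have := h (i, phi i); rewrite /mix/= addbb.
    by have := h (i, ~~ phi i); rewrite /mix/= addNb addbb.
  move=> [h h'] [i b]; rewrite /mix/=; have := h i; have := h' i.
  by case: b; case: (phi i).
rewrite product_measure1E; [|exact: measurable_rect|exact: measurable_rect].
have i1 := indepX (B := fun i => B (i, phi i)) (fun i => mB _).
have i2 := indepX (B := fun i => B (i, ~~ phi i)) (fun i => mB _).
apply: etrans (congr2 (fun a b => (a * b)%E) i1 i2) _.
rewrite -EFinM -big_split/=; congr EFin; apply: eq_bigr => i _.
by case: (phi i); rewrite //= mulrC.
Qed.

Lemma eq_mix_integral (phi psi : I -> bool) (H : (I * bool -> R) -> R) :
  coord_measurable H -> (forall x, 0 <= H x) ->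
  \int[(P \x P)%E]_z H (mix (fun ib => ib.2 (+) phi ib.1) ^~ z) =
  \int[(P \x P)%E]_z H (mix (fun ib => ib.2 (+) psi ib.1) ^~ z).
Proof.
move=> mH H0; rewrite /Rintegral; congr fine.
apply: (eq_law_integral (P1 := (P \x P)%E) (P2 := (P \x P)%E)) => //.
- by move=> i; exact: measurable_mix.
- by move=> i; exact: measurable_mix.
- by move=> B mB; exact: etrans (mix_rect phi mB) (esym (mix_rect psi mB)).
Qed.

Lemma Rintegral_prod (u v : T -> R) : measurable_fun setT u -> measurable_fun setT v ->
  (forall w, 0 <= u w) -> (forall w, 0 <= v w) ->
  P.-integrable setT (EFin \o u) -> P.-integrable setT (EFin \o v) ->
  \int[(P \x P)%E]_z (u z.1 * v z.2) = (\int[P]_w u w) * (\int[P]_w v w).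
Proof.
move=> mu mv u0 v0 iu iv; rewrite /Rintegral fubini_tonelli1; last 2 first.
- by apply/measurable_EFinP/measurable_funM; apply: measurableT_comp.
- by move=> z; rewrite lee_fin mulr_ge0.
rewrite /fubini_F/=.
under eq_integral => w _.
  under eq_integral do rewrite EFinM.
  rewrite ge0_integralZl//; last 3 first.
  - exact/measurable_EFinP.
  - by move=> *; rewrite lee_fin.
  - by rewrite lee_fin.
  over.
have fv : (\int[P]_w (v w)%:E)%E \is a fin_num by exact: integrable_fin_num.
have fu : (\int[P]_w (u w)%:E)%E \is a fin_num by exact: integrable_fin_num.
rewrite ge0_integralZr//; last 3 first.
- exact/measurable_EFinP.
- by move=> *; rewrite lee_fin.
- by apply: integral_ge0 => *; rewrite lee_fin.
by rewrite fineM.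
Qed.

Variables (f g : (I -> R) -> R) (c : R).
Hypotheses (mf : coord_measurable f) (mg : coord_measurable g).
Hypotheses (f0 : forall x, 0 <= f x) (g0 : forall x, 0 <= g x).
Hypotheses (fc : forall x, f x <= c) (gc : forall x, g x <= c).
Hypothesis X0 : forall i w, 0 <= X i w.

(** Only nonnegative starting points are considered: the functions used later depend on absolute
    values of the coordinates and are monotone only there. *)
Definition coord_mono (h : (I -> R) -> R) := forall i (x y : I -> R),
  (forall j, 0 <= x j) -> x i <= y i -> (forall j, j != i -> y j = x j) -> h x <= h y.

Hypotheses (fm : coord_mono f) (gm : coord_mono g).

Definition hyb (A : pred I) (z : T * T) : I -> R := fun i => X i (if A i then z.2 else z.1).

Lemma measurable_hyb h A : coord_measurable h -> measurable_fun setT (fun z => h (hyb A z)).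
Proof.
move=> mh; apply: (mh _ _ (fun i z => hyb A z i)) => i.
by rewrite /hyb; case: (A i); apply: measurableT_comp.
Qed.

Let integ A B : (P \x P)%E.-integrable setT (EFin \o (fun z => f (hyb A z) * g (hyb B z))).
Proof.
apply: (@bounded_integrable _ _ _ _ _ (c * c)).
  by apply: measurable_funM; exact: measurable_hyb.
by move=> z; rewrite normrM !ger0_norm// ler_pM.
Qed.

(** An interpolation: the empty [A] gives [E [f g]] and the full one [E f * E g], since [g] then
    reads only the independent copy. *)
Definition corr (A : pred I) : R := \int[(P \x P)%E]_z (f (hyb pred0 z) * g (hyb A z)).

(* Exchanging the two copies of coordinate [i] preserves the law, so twice the
   difference is the mean of a product of two increments of the same sign. *)
Lemma corr_step A i : ~~ A i -> corr (predU (pred1 i) A) <= corr A.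
Proof.
move=> Ai.
have sw B C (psi : I -> bool) :
    \int[(P \x P)%E]_z (f (hyb B z) * g (hyb C z)) =
    \int[(P \x P)%E]_z (f (hyb (fun j => B j (+) psi j) z) * g (hyb (fun j => C j (+) psi
      j) z)).
  pose H (y : I * bool -> R) := f (fun j => y (j, B j)) * g (fun j => y (j, C j)).
  have mH : coord_measurable H.
    by move=> d' T' Y mY; apply: measurable_funM; [apply: (mf (Y := fun j => Y (j, B
      j)))|apply: (mg (Y := fun j => Y (j, C j)))].
  have H0 x : 0 <= H x by rewrite /H mulr_ge0.
  apply: etrans (etrans _ (eq_mix_integral (fun=> false) psi mH H0)) _ => //.
  apply: eq_Rintegral => z _; rewrite /H/=; congr (f _ * g _); apply/funext => j;
    by rewrite /hyb /mix/= addbF.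
have e1 := sw pred0 A (pred1 i).
have e2 := sw pred0 (predU (pred1 i) A) (pred1 i).
have hU : hyb (fun j => A j (+) (pred1 i) j) = hyb (predU (pred1 i) A).
  apply/funext => z; apply/funext => j; rewrite /hyb/=.
  by have [->|ji] := eqVneq j i; rewrite ?(negbTE Ai)// addbF.
have hA : hyb (fun j => (predU (pred1 i) A) j (+) (pred1 i) j) = hyb A.
  apply/funext => z; apply/funext => j; rewrite /hyb/=.
  by have [->|ji] := eqVneq j i; rewrite ?(negbTE Ai)// addbF.
rewrite hU in e1; rewrite hA in e2.
rewrite -/(corr _) in e1 e2.
have h1 : hyb (fun j => pred0 j (+) (pred1 i) j) = hyb (pred1 i) by [].
rewrite h1 in e1 e2.
suff : corr (predU (pred1 i) A) + corr (predU (pred1 i) A) <= corr A + corr A by lra.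
rewrite [X in _ + X <= _]e2 [X in _ <= _ + X]e1 /corr.
rewrite -!RintegralD//; [|exact: integ..].
apply: le_Rintegral => //.
- by apply: (@integrableD _ _ _ _ _ _ _ _ (integ _ _) (integ _ _)).
- by apply: (@integrableD _ _ _ _ _ _ _ _ (integ _ _) (integ _ _)).
move=> z _.
set a := f _; set b := g (hyb (predU _ _) z); set a' := f _; set b' := g _.
rewrite -subr_ge0.
have -> : a * b' + a' * b - (a * b + a' * b') = (a' - a) * (b - b') by ring.
have hyb0 B j : 0 <= hyb B z j by exact: X0.
have [le|/ltW le] := leP (X i z.1) (X i z.2).
  apply: mulr_ge0; rewrite subr_ge0.
    apply: (fm (i := i)) => //; rewrite /hyb/= ?eqxx// => j /negbTE ->//.
  apply: (gm (i := i)) => //; rewrite /hyb/= ?eqxx ?(negbTE Ai)// => j /negbTE ->//.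
rewrite -mulrNN !opprB; apply: mulr_ge0; rewrite subr_ge0.
  apply: (fm (i := i)) => //; rewrite /hyb/= ?eqxx// => j /negbTE ->//.
apply: (gm (i := i)) => //; rewrite /hyb/= ?eqxx ?(negbTE Ai)// => j /negbTE ->//.
Qed.

Lemma corr_le (s : seq I) : corr (mem s) <= corr pred0.
Proof.
elim: s => [|i s IH]; first by rewrite le_eqVlt; apply/orP; left.
apply: le_trans IH; have [si|si] := boolP (i \in s).
  rewrite le_eqVlt; apply/orP; left; apply/eqP; congr corr.
  by apply/funext => j /=; rewrite inE; have [->|] := eqVneq j i; rewrite ?si.
apply: le_trans (corr_step si); rewrite le_eqVlt; apply/orP; left; apply/eqP; congr corr.
Qed.

Lemma harris : (\int[P]_w f (X ^~ w)) * (\int[P]_w g (X ^~ w)) <=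
  \int[P]_w (f (X ^~ w) * g (X ^~ w)).
Proof.
have mfX : measurable_fun setT (fun w => f (X ^~ w)) by exact: mf.
have mgX : measurable_fun setT (fun w => g (X ^~ w)) by exact: mg.
have ifX : P.-integrable setT (EFin \o (fun w => f (X ^~ w))).
  by apply: (@bounded_integrable _ _ _ _ _ (c)) => // w; rewrite ger0_norm.
have igX : P.-integrable setT (EFin \o (fun w => g (X ^~ w))).
  by apply: (@bounded_integrable _ _ _ _ _ (c)) => // w; rewrite ger0_norm.
rewrite -Rintegral_prod//.
have -> : \int[P]_w (f (X ^~ w) * g (X ^~ w)) = corr pred0.
  transitivity (\int[(P \x P)%E]_z ((f (X ^~ z.1) * g (X ^~ z.1)) * cst 1 z.2)); last first.
    by apply: eq_Rintegral => z _; rewrite /= mulr1.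
  rewrite (@Rintegral_prod (fun w => f (X ^~ w) * g (X ^~ w)) (cst 1))//.
  - by rewrite [X in _ * X]Rintegral_prob_cst mulr1.
  - exact: measurable_funM.
  - by move=> w; rewrite mulr_ge0.
  - apply: (@bounded_integrable _ _ _ _ _ (c * c)); first exact: measurable_funM.
    by move=> w; rewrite normrM !ger0_norm// ler_pM.
  - by apply: (@bounded_integrable _ _ _ _ _ (1)) => // w; rewrite normr1.
apply: le_trans (corr_le (enum I)); rewrite le_eqVlt; apply/orP; left; apply/eqP.
apply: eq_Rintegral => z _; congr (f _ * g _); apply/funext => i.
by rewrite /hyb/= mem_enum.
Qed.

End Harris.

(** * Concentration over the disorder *)

Section Measurability.
Variables (R : realType) (n : nat) (d : measure_display) (T : measurableType d).
Variable K : T -> {set 'I_n} -> R.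
Hypothesis mK : forall X, measurable_fun setT (fun w => K w X).

Lemma measurable_wK s : measurable_fun setT (fun w => wK (K w) s).
Proof.
apply: measurableT_comp; first exact: measurable_expR.
by apply: measurable_sum => X; exact: measurable_funM.
Qed.

Lemma measurable_ZK : measurable_fun setT (fun w => ZK (K w)).
Proof. by apply: measurable_sum => s; exact: measurable_wK. Qed.

Lemma measurable_av f : measurable_fun setT (fun w => av (K w) f).
Proof.
(* As [Z > 0], its inverse is [exp (- ln Z)], a composition of measurable functions. *)
have -> : (fun w => av (K w) f) = (fun w => (\sum_s f s * wK (K w) s) * expR (- ln (ZK (K
  w)))).
  by apply/funext => w; rewrite expRN lnK ?posrE ?ZK_gt0.
apply: measurable_funM.
  by apply: measurable_sum => s; apply: measurable_funM => //; exact: measurable_wK.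
apply: measurableT_comp; first exact: measurable_expR.
apply: measurableT_comp => //.
by apply: measurableT_comp; [exact: measurable_ln|exact: measurable_ZK].
Qed.

Lemma measurable_qk k : measurable_fun setT (fun w => qk k (K w)).
Proof.
apply: measurable_funM => //; apply: measurable_sum => i.
by apply: measurable_funX; exact: measurable_av.
Qed.

Lemma measurable_qm : measurable_fun setT (fun w => qm (K w)).
Proof. exact: (measurable_qk 1). Qed.

Lemma measurable_Pm : measurable_fun setT (fun w => Pm (K w)).
Proof.
apply: measurable_funM => //.
by apply: measurableT_comp; [exact: measurable_ln|exact: measurable_ZK].
Qed.

End Measurability.

(** * Variance of the overlap means over the disorder *)

Section Disorder.
Variables (R : realType) (n : nat) (d : measure_display) (T : measurableType d).
Variables (P : probability T R) (J : {set 'I_n} -> T -> R) (tau : 'I_n -> T -> nat) (h1 :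
  R).
Hypothesis n0 : (0 < n)%N.
Hypothesis mJ : forall X, measurable_fun setT (J X).
Hypothesis J0 : forall X w, 0 <= J X w.
Hypothesis mtau : forall i (Y : set nat), measurable (tau i @^-1` Y)%classic.
Hypothesis ind : indep_family P J tau.
Hypothesis h1_ge0 : 0 <= h1.

(** Couplings and Poisson variables merged into one real family, the form required by Harris'
    inequality. *)
Definition coords (i : {set 'I_n} + 'I_n) (w : T) : R :=
  match i with inl X => J X w | inr i => (tau i w)%:R end.

Lemma measurable_coords i : measurable_fun setT (coords i).
Proof.
case: i => [X|i]; first exact: mJ.
move=> _ B mB; rewrite setTI.
have -> : (coords (inr i) @^-1` B = tau i @^-1` [set m | B m%:R])%classic by [].
exact: mtau.
Qed.

Lemma coords_ge0 i w : 0 <= coords i w.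
Proof. by case: i => [X|i] /=. Qed.

Lemma indep_coords (B : {set 'I_n} + 'I_n -> set R) : (forall i, measurable (B i)) ->
  P (rect coords B) = (\prod_i fine (P (coords i @^-1` B i)%classic))%:E.
Proof.
move=> mB; rewrite big_sumType/=.
rewrite -(ind (B := fun X => B (inl X)) (fun i => [set m | B (inr i) m%:R]%classic));
  last by move=> X; exact: mB.
congr (P _); apply/seteqP; split => w /=.
  by move=> h; split => i; [have := h (inl i)|have := h (inr i)].
by move=> [h h'] [X|i]; [exact: h|exact: h'].
Qed.

(* Absolute values make the effective couplings nonnegative for every [x], not
   only for the values taken by the disorder. *)
Definition Kx (h : R) (x : {set 'I_n} + 'I_n -> R) : {set 'I_n} -> R :=
  addh (fields (fun X => `|x (inl X)|) (fun i => `|x (inr i)|) h1) h.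

Definition Kw (h : R) (w : T) : {set 'I_n} -> R :=
  addh (fields (J ^~ w) (fun i => (tau i w)%:R) h1) h.

Lemma Kx_coords h w : Kx h (coords ^~ w) = Kw h w.
Proof.
rewrite /Kx /Kw; congr (addh (fields _ _ _) _); apply/funext => i /=.
  by rewrite ger0_norm.
by rewrite ger0_norm.
Qed.

Lemma Kx_ge0 h x : 0 <= h -> forall X, 0 <= Kx h x X.
Proof. by move=> h_0; apply: addh_ge0 => //; exact: fields_ge0. Qed.

Lemma Kw_ge0 h w : 0 <= h -> forall X, 0 <= Kw h w X.
Proof. by move=> h_0; rewrite -Kx_coords; exact: Kx_ge0. Qed.

Lemma KwD h h' w : addh (Kw h w) h' = Kw (h + h') w.
Proof. exact: addhK. Qed.

Lemma measurable_Kx h d' (T' : measurableType d') (Y : {set 'I_n} + 'I_n -> T' -> R) X :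
  (forall i, measurable_fun setT (Y i)) -> measurable_fun setT (fun w => Kx h (Y ^~ w) X).
Proof.
move=> mY; apply: measurable_funD.
  apply: measurable_funD; first by apply: measurableT_comp => //; exact: mY.
  apply: measurable_sum => i; apply: measurable_funM => //; apply: measurable_funM => //.
  by apply: measurableT_comp => //; exact: mY.
by apply: measurable_sum => i; apply: measurable_funM.
Qed.

Lemma measurable_Kw h X : measurable_fun setT (fun w => Kw h w X).
Proof.
have := measurable_Kx h X measurable_coords.
by under eq_fun do rewrite Kx_coords.
Qed.

Lemma coord_measurable_qk k h : coord_measurable (fun x => qk k (Kx h x)).
Proof. by move=> d' T' Y mY; apply: measurable_qk => X; exact: measurable_Kx. Qed.

(** Raising one disorder coordinate changes a single effective coupling, on [X] for [J_X] and on the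
    singleton of [i] for [tau_i], so monotonicity in one coupling is enough. *)
Lemma Kx_coord h i (x y : {set 'I_n} + 'I_n -> R) :
  (forall j, 0 <= x j) -> x i <= y i -> (forall j, j != i -> y j = x j) ->
  exists X0, Kx h x X0 <= Kx h y X0 /\ forall X, X != X0 -> Kx h y X = Kx h x X.
Proof.
move=> x0 xy xyE; have y0 j : 0 <= y j.
  by have [->|/xyE ->//] := eqVneq j i; exact: le_trans xy.
case: i xy xyE => [X0|i0] xy xyE.
  exists X0; rewrite /Kx /addh /fields; split => [|X XX0].
    rewrite !lerD2r// (ger0_norm (x0 _)) (ger0_norm (y0 _)).
    have -> : \sum_(i < n) (X0 == [set i])%:R * (h1 * `|x (inr i)|) =
              \sum_(i < n) (X0 == [set i])%:R * (h1 * `|y (inr i)|).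
      by apply: eq_bigr => i _; rewrite xyE.
    by rewrite lerD2r.
  congr (_ + _ + _); first by rewrite xyE//; apply: contra_neq XX0 => -[].
  by apply: eq_bigr => i _; rewrite xyE.
exists [set i0]; rewrite /Kx /addh /fields; split => [|X XX0].
  rewrite lerD2r// xyE// lerD2l; apply: ler_sum => i _.
  rewrite ler_wpM2l// ler_wpM2l// (ger0_norm (x0 _)) (ger0_norm (y0 _)).
  by have [->//|ii] := eqVneq i i0; rewrite xyE//; apply: contra_neq ii => -[].
congr (_ + _ + _); first by rewrite xyE.
apply: eq_bigr => i _; have [->|ii] := eqVneq i i0; first by rewrite (negbTE XX0) !mul0r.
by rewrite xyE//; apply: contra_neq ii => -[].
Qed.

Lemma qk_integrable k h : 0 <= h -> P.-integrable setT (EFin \o (fun w => qk k (Kw h w))).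
Proof.
move=> h_0; apply: (@bounded_integrable _ _ _ _ _ 1).
  by apply: measurable_qk => X; exact: measurable_Kw.
by move=> w; rewrite ger0_norm ?qk_ge0 ?qk_le1//; exact: Kw_ge0.
Qed.

Lemma qk_sqr_integrable k h : 0 <= h -> P.-integrable setT (EFin \o (fun w => qk k (Kw h
  w) ^+ 2)).
Proof.
move=> h_0; apply: (@bounded_integrable _ _ _ _ _ 1).
  by apply: measurable_funX; apply: measurable_qk => X; exact: measurable_Kw.
by move=> w; rewrite ger0_norm ?sqr_ge0// exprn_ile1 ?qk_ge0 ?qk_le1//; exact: Kw_ge0.
Qed.

Lemma Eqk_sqr k h : 0 <= h ->
  \int[P]_w (qk k (Kw h w) - \int[P]_w qk k (Kw h w)) ^+ 2 =
  \int[P]_w (qk k (Kw h w) ^+ 2) - (\int[P]_w qk k (Kw h w)) ^+ 2.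
Proof.
move=> h_0; set m := \int[P]_w qk k (Kw h w).
have i1 := qk_integrable k h_0; have i2 := qk_sqr_integrable k h_0.
have i1m : P.-integrable setT (EFin \o (fun w => - 2 * m * qk k (Kw h w))).
  by have := integrableZl measurableT (- 2 * m) i1; apply: eq_integrable.
have ic : P.-integrable setT (EFin \o (fun w => m ^+ 2)).
  by apply: (@bounded_integrable _ _ _ _ _ `|m ^+ 2|).
rewrite (@eq_Rintegral _ _ _ _ _ (fun w => qk k (Kw h w) ^+ 2 + (- 2 * m * qk k (Kw h w)
  + m ^+ 2))); last first.
  by move=> w _; ring.
rewrite RintegralD//; last exact: (@integrableD _ _ _ _ _ _ _ _ i1m ic).
rewrite RintegralD// RintegralZl// Rintegral_prob_cst -/m; ring.
Qed.

(** As [f g = k^2 <Q_1>^2 - <Q_k>^2], the covariance of [f] and [g] is exactly the right-hand side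
    minus the left-hand side, and Harris makes it nonnegative. *)
Lemma var_qk_le k h : (0 < k)%N -> 0 <= h ->
  \int[P]_w (qk k (Kw h w) - \int[P]_w qk k (Kw h w)) ^+ 2 <=
  k%:R ^+ 2 * \int[P]_w (qm (Kw h w) - \int[P]_w qm (Kw h w)) ^+ 2.
Proof.
move=> k0 h_0.
pose f x := k%:R * qk 1 (Kx h x) - qk k (Kx h x).
pose g x := k%:R * qk 1 (Kx h x) + qk k (Kx h x).
have k1 : (1 : R) <= k%:R by rewrite ler1n.
have qkk x : qk k (Kx h x) <= k%:R * qk 1 (Kx h x).
  rewrite /qk mulrCA ler_wpM2l// mulr_sumr; apply: ler_sum => i _; rewrite expr1.
  have := @subX_le R (ms (Kx h x) [set i]) 0 k; rewrite subr0 expr0n gtn_eqF//= subr0;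
    apply => //.
    by apply: ms_ge0; exact: Kx_ge0.
  exact: ms_le1.
have q1 x : 0 <= qk 1 (Kx h x) <= 1 by rewrite qk_ge0 ?qk_le1//; exact: Kx_ge0.
have q2 x : 0 <= qk k (Kx h x) <= 1 by rewrite qk_ge0 ?qk_le1//; exact: Kx_ge0.
have kq x : k%:R * qk 1 (Kx h x) <= k%:R by rewrite ler_piMr//; case/andP: (q1 x).
have kq0 x : 0 <= k%:R * qk 1 (Kx h x) by rewrite mulr_ge0//; case/andP: (q1 x).
have H : (\int[P]_w f (coords ^~ w)) * (\int[P]_w g (coords ^~ w)) <= \int[P]_w (f
  (coords ^~ w) * g (coords ^~ w)).
  apply: (@harris _ _ _ _ _ _ measurable_coords indep_coords f g (k%:R + 1)).
  - move=> d' T' Y mY; apply: measurable_funB; last exact: coord_measurable_qk.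
    by apply: measurable_funM => //; exact: coord_measurable_qk.
  - move=> d' T' Y mY; apply: measurable_funD; last exact: coord_measurable_qk.
    by apply: measurable_funM => //; exact: coord_measurable_qk.
  - by move=> x; rewrite subr_ge0.
  - by move=> x; have := q2 x; have := kq0 x; rewrite /g; lra.
  - by move=> x; have := q2 x; have := kq x; rewrite /f; lra.
  - by move=> x; have := q2 x; have := kq x; rewrite /g; lra.
  - exact: coords_ge0.
  - move=> i x y x0 xy xyE; have [X0 [K1 K2]] := Kx_coord h x0 xy xyE.
    by have [] := qk_mono k (Kx_ge0 x h_0) K1 K2.
  - move=> i x y x0 xy xyE; have [X0 [K1 K2]] := Kx_coord h x0 xy xyE.
    have [A _] := qk_mono k (Kx_ge0 x h_0) K1 K2.
    have [B _] := qk_mono 1 (Kx_ge0 x h_0) K1 K2.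
    by rewrite /g lerD// ler_wpM2l.
have i1 := qk_integrable 1 h_0; have ik := qk_integrable k h_0.
have i12 := qk_sqr_integrable 1 h_0; have ik2 := qk_sqr_integrable k h_0.
have i1k : P.-integrable setT (EFin \o (fun w => k%:R * qk 1 (Kw h w))).
  by have := integrableZl measurableT k%:R i1; apply: eq_integrable.
have i1k2 : P.-integrable setT (EFin \o (fun w => k%:R ^+ 2 * qk 1 (Kw h w) ^+ 2)).
  by have := integrableZl measurableT (k%:R ^+ 2) i12; apply: eq_integrable.
have Ef : \int[P]_w f (coords ^~ w) = k%:R * \int[P]_w qk 1 (Kw h w) - \int[P]_w qk k (Kw
  h w).
  rewrite -(RintegralZl k%:R measurableT i1) -(RintegralB measurableT i1k ik).
  by apply: eq_Rintegral => w _; rewrite /f Kx_coords.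
have Eg : \int[P]_w g (coords ^~ w) = k%:R * \int[P]_w qk 1 (Kw h w) + \int[P]_w qk k (Kw
  h w).
  rewrite -(RintegralZl k%:R measurableT i1) -(RintegralD measurableT i1k ik).
  by apply: eq_Rintegral => w _; rewrite /g Kx_coords.
have Efg : \int[P]_w (f (coords ^~ w) * g (coords ^~ w)) =
    k%:R ^+ 2 * \int[P]_w (qk 1 (Kw h w) ^+ 2) - \int[P]_w (qk k (Kw h w) ^+ 2).
  rewrite -(RintegralZl (k%:R ^+ 2) measurableT i12) -(RintegralB measurableT i1k2 ik2).
  by apply: eq_Rintegral => w _; rewrite /f /g Kx_coords; ring.
rewrite Eqk_sqr// -/(qk 1 _).
have := Eqk_sqr 1 h_0.
rewrite (_ : (fun w => (qm _ - _) ^+ 2) = (fun w => (qk 1 (Kw h w) - \int[P]_w qk 1 (Kw h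
  w)) ^+ 2))//.
move=> ->; rewrite Ef Eg Efg in H; move: H.
set a := \int[P]_w _; set b := \int[P]_w _; set c := \int[P]_w _; set e := \int[P]_w _.
rewrite -subr_ge0 => H; rewrite -subr_ge0; apply: le_trans H _.
by rewrite le_eqVlt; apply/orP; left; apply/eqP; ring.
Qed.

End Disorder.

(** * Integrability deduced from a bound on the variance *)

Section FiniteVariance.
Variables (R : realType) (d : measure_display) (T : measurableType d) (P : probability T R).
Variables (F : T -> R) (v : R).
Hypotheses (mF : measurable_fun setT F) (Fv : (Var P F <= v%:E)%E).

Lemma Var_sqr_integrable :
  P.-integrable setT (EFin \o (fun w => (F w - \int[P]_w F w) ^+ 2)).
Proof.
apply/integrableP; split.
  by apply/measurable_EFinP; apply: measurable_funX; apply: measurable_funB.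
rewrite (le_lt_trans _ (ltry v))//; apply: le_trans Fv.
rewrite /Var /Ex le_eqVlt; apply/orP; left; apply/eqP.
by apply: eq_integral => w _; rewrite gee0_abs// lee_fin sqr_ge0.
Qed.

Lemma Var_Rintegral_le : \int[P]_w ((F w - \int[P]_w F w) ^+ 2) <= v.
Proof.
rewrite -lee_fin /Rintegral fineK; first exact: Fv.
exact: integrable_fin_num Var_sqr_integrable.
Qed.

(** The centre [c] is a real number by convention even before [F] is known to be integrable.
    Finiteness of [E (F - c)^2] suffices, because [|F| <= |c| + 1 + (F - c)^2]. *)
Lemma Var_integrable : P.-integrable setT (EFin \o F).
Proof.
set c := \int[P]_w F w.
have i0 : P.-integrable setT (EFin \o (fun w => (`|c| + 1) + (F w - c) ^+ 2)).
  have ic : P.-integrable setT (EFin \o (fun _ : T => `|c| + 1)).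
    by apply: (@bounded_integrable _ _ _ _ _ (Num.norm (`|c| + 1))).
  exact: (@integrableD _ _ _ _ _ _ _ _ ic Var_sqr_integrable).
apply: le_integrable i0 => //; first exact/measurable_EFinP.
move=> w _; rewrite /= lee_fin [leRHS]ger0_norm; last by rewrite addr_ge0// sqr_ge0.
have : `|F w| <= `|F w - c| + `|c| by rewrite -{1}(subrK c (F w)) ler_normD.
rewrite -(real_normK (num_real (F w - c))); set x := `|F w - c|.
have : 0 <= (x - 1) ^+ 2 by exact: sqr_ge0.
have : 0 <= x by exact: normr_ge0.
have -> : (x - 1) ^+ 2 = x ^+ 2 - 2 * x + 1 by ring.
lra.
Qed.
End FiniteVariance.

(** * From concentration of the pressure to concentration of the overlaps *)

Section Concentration.
Variables (R : realType) (n : nat) (d : measure_display) (T : measurableType d).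
Variables (P : probability T R) (J : {set 'I_n} -> T -> R) (tau : 'I_n -> T -> nat) (h1 :
  R).
Hypothesis n0 : (0 < n)%N.
Hypothesis mJ : forall X, measurable_fun setT (J X).
Hypothesis J0 : forall X w, 0 <= J X w.
Hypothesis mtau : forall i (Y : set nat), measurable (tau i @^-1` Y)%classic.
Hypothesis ind : indep_family P J tau.
Hypothesis h1_ge0 : 0 <= h1.
Local Notation Kw := (Kw J tau h1).

Definition rq h : R := \int[P]_w qm (Kw h w).

Lemma qm_integrable h : 0 <= h -> P.-integrable setT (EFin \o (fun w => qm (Kw h w))).
Proof. by move=> h_0; apply: (qk_integrable P n0 mJ J0 mtau h1_ge0 1). Qed.

Lemma rq_ge0 h : 0 <= h -> 0 <= rq h.
Proof. by move=> h_0; apply: Rintegral_ge0 => w _; apply: qm_ge0; exact: Kw_ge0. Qed.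

Lemma rq_le1 h : 0 <= h -> rq h <= 1.
Proof.
move=> h_0; rewrite -[leRHS](Rintegral_prob_cst P); apply: le_Rintegral => //.
- exact: qm_integrable.
- by apply: (@bounded_integrable _ _ _ _ _ `|1|).
- by move=> w _; exact: qm_le1.
Qed.

Lemma rq_mono h h' : 0 <= h -> h <= h' -> rq h <= rq h'.
Proof.
move=> h_0 hh'; apply: le_Rintegral => //.
- exact: qm_integrable.
- by apply: qm_integrable; exact: le_trans hh'.
move=> w _; have -> : Kw h' w = addh (Kw h w) (h' - h) by rewrite KwD subrKC.
by apply: qm_addh_mono => //; rewrite subr_ge0.
Qed.

Lemma measurable_PmK h : measurable_fun setT (fun w => Pm (Kw h w)).
Proof. by apply: measurable_Pm => X; exact: measurable_Kw. Qed.

Lemma Pm_slope h del w : del * qm (Kw h w) <= Pm (Kw (h + del) w) - Pm (Kw h w) <= del *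
  qm (Kw (h + del) w).
Proof. by rewrite -KwD Pm_addh_ge// Pm_addh_le. Qed.

Lemma Rintegral_scale_integrable (f : T -> R) (c : R) :
  P.-integrable setT (EFin \o f) -> P.-integrable setT (EFin \o (fun w => c * f w)).
Proof. by move=> fi; have := integrableZl measurableT c fi; apply: eq_integrable. Qed.

(** The slope bounds hold for every disorder and, after integration, for the mean pressure, so the
    deviation bound for slopes of convex functions applies pointwise. Its three squared pressure
    deviations have mean at most [v] each, whence 18 = 6 * 3. *)
Lemma var_qm_le h del v : 0 < del -> 0 <= h - del ->
  (forall u, u \in [:: h - del; h; h + del] -> (Var P (fun w => Pm (Kw u w)) <= v%:E)%E) ->
  \int[P]_w ((qm (Kw h w) - rq h) ^+ 2) <=
  18 * v / del ^+ 2 + 2 * (rq (h + del) - rq (h - del)).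
Proof.
move=> del0 hd V.
have h_0 : 0 <= h by lra.
have hp : 0 <= h + del by lra.
have hdp : h - del <= h + del by lra.
have Vm : (Var P (fun w => Pm (Kw (h - del) w)) <= v%:E)%E by apply: V; rewrite !inE eqxx.
have V0 : (Var P (fun w => Pm (Kw h w)) <= v%:E)%E by apply: V; rewrite !inE eqxx orbT.
have Vp : (Var P (fun w => Pm (Kw (h + del) w)) <= v%:E)%E by apply: V; rewrite !inE eqxx
  !orbT.
pose p u := \int[P]_w Pm (Kw u w).
pose D u w := (Pm (Kw u w) - p u) ^+ 2.
have iP u : (Var P (fun w => Pm (Kw u w)) <= v%:E)%E ->
    P.-integrable setT (EFin \o (fun w => Pm (Kw u w))).
  by apply: Var_integrable; exact: measurable_PmK.
have iD u : (Var P (fun w => Pm (Kw u w)) <= v%:E)%E -> P.-integrable setT (EFin \o D u).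
  by apply: Var_sqr_integrable; exact: measurable_PmK.
have bD u : (Var P (fun w => Pm (Kw u w)) <= v%:E)%E -> \int[P]_w D u w <= v.
  by apply: Var_Rintegral_le; exact: measurable_PmK.
have sl u del' : 0 <= u -> 0 <= u + del' -> (Var P (fun w => Pm (Kw u w)) <= v%:E)%E ->
   (Var P (fun w => Pm (Kw (u + del') w)) <= v%:E)%E ->
   del' * rq u <= p (u + del') - p u <= del' * rq (u + del').
  move=> u0 u1 V1 V2; rewrite /p -(RintegralB measurableT (iP _ V2) (iP _ V1)).
  rewrite /rq -(RintegralZl del' measurableT (qm_integrable u0)).
  rewrite -(RintegralZl del' measurableT (qm_integrable u1)).
  have iB : P.-integrable setT (EFin \o (fun w => Pm (Kw (u + del') w) - Pm (Kw u w))).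
    exact: (@integrableB _ _ _ _ _ _ _ _ (iP _ V2) (iP _ V1)).
  apply/andP; split; apply: le_Rintegral => //.
  - exact: Rintegral_scale_integrable (qm_integrable u0).
  - by move=> w _; case/andP: (Pm_slope u del' w).
  - exact: Rintegral_scale_integrable (qm_integrable u1).
  - by move=> w _; case/andP: (Pm_slope u del' w).
have /andP[s1 s2] := sl _ del h_0 hp V0 Vp.
have := sl _ (- del) h_0 hd V0 Vm; move=> /andP[s3 s4].
set Del := rq (h + del) - rq (h - del).
have Del0 : 0 <= Del by rewrite /Del subr_ge0; apply: rq_mono.
(* This lets the deviation bound be linear in [Del] rather than quadratic, and only the linear form
   telescopes when integrated over the field. *)
have Del1 : Del <= 1 by apply: le_trans (rq_le1 hp); rewrite /Del gerBl; exact: rq_ge0.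
have key w : (qm (Kw h w) - rq h) ^+ 2 <=
   6 / del ^+ 2 * (D (h + del) w + (D h w + D (h - del) w)) + 2 * Del.
  have /andP[t1 t2] := Pm_slope h del w.
  have /andP[t3 t4] := Pm_slope h (- del) w.
  exact: (sqr_dev_le del0 t1 t3 s1 s2 s3 s4 Del0 Del1).
have iS : P.-integrable setT (EFin \o (fun w => D h w + D (h - del) w)).
  exact: (@integrableD _ _ _ _ _ _ _ _ (iD _ V0) (iD _ Vm)).
have iS' : P.-integrable setT (EFin \o (fun w => D (h + del) w + (D h w + D (h - del) w))).
  exact: (@integrableD _ _ _ _ _ _ _ _ (iD _ Vp) iS).
have iS2 := Rintegral_scale_integrable (6 / del ^+ 2) iS'.
have ic : P.-integrable setT (EFin \o (fun _ : T => 2 * Del)).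
  by apply: (@bounded_integrable _ _ _ _ _ `|2 * Del|).
apply: (@le_trans _ _ (\int[P]_w (6 / del ^+ 2 * (D (h + del) w + (D h w + D (h - del)
  w)) + 2 * Del))).
  apply: le_Rintegral; first exact: measurableT.
  - apply: (@bounded_integrable _ _ _ _ _ 1).
      apply: measurable_funX; apply: measurable_funB => //.
      by apply: measurable_qm => X; exact: measurable_Kw.
    move=> w; apply: normr_sqr_dist_le1; last by rewrite rq_ge0 ?rq_le1.
    by rewrite qm_ge0 ?qm_le1//; exact: Kw_ge0.
  - exact: (@integrableD _ _ _ _ _ _ _ _ iS2 ic).
  - by move=> w _; exact: key.
rewrite (RintegralD measurableT iS2 ic) Rintegral_prob_cst lerD2r.
rewrite (RintegralZl _ measurableT iS') (RintegralD measurableT (iD _ Vp) iS).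
rewrite (RintegralD measurableT (iD _ V0) (iD _ Vm)).
have -> : 18 * v / del ^+ 2 = 6 / del ^+ 2 * (v + (v + v)) by ring.
apply: ler_wpM2l; first by rewrite divr_ge0// exprn_ge0// ltW.
by apply: lerD; [exact: bD|apply: lerD; exact: bD].
Qed.

(** Disorder average of the single-sample bound: the thermal variance costs an increment of [rq]
    over [1/n], the disorder variance [k^2] times that of [<Q_1>]. *)
Lemma Ex_gibbs_dev h del eps v k p (m := fine (Ex P (fun w => gibbs (J ^~ w) (tau ^~ w) h
  h1 (@Qk R n k)))) :
  (0 < k)%N -> 0 < eps -> 0 < del -> 0 <= h - del ->
  (forall u, u \in [:: h - del; h; h + del] -> (Var P (fun w => Pm (Kw u w)) <= v%:E)%E) ->
  (Ex P (fun w => gibbs (J ^~ w) (tau ^~ w) h h1 (fun ss => (`|@Qk R n k ss ^+ p - m ^+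
    p|)%R)) <=
  (p%:R * (eps / 2 + (k%:R * (8 * (rq (h + n%:R^-1) - rq h)) +
     k%:R ^+ 2 * (18 * v / del ^+ 2 + 2 * (rq (h + del) - rq (h - del)))) / (2 *
       eps)))%R%:E)%E.
Proof.
move=> k0 e0 del0 hd V.
have h_0 : 0 <= h by lra.
have e2 : 0 <= 2 * eps by rewrite mulr_ge0// ltW.
have hn : 0 <= h + n%:R^-1 by rewrite addr_ge0.
have mE : m = \int[P]_w qk k (Kw h w).
  by rewrite /m /Ex; apply: eq_Rintegral => w _; rewrite gibbs_Qk.
have K0 w : forall X, 0 <= Kw h w X by exact: Kw_ge0.
have m0 : 0 <= m by rewrite mE Rintegral_ge0// => w _; rewrite qk_ge0.
have iq := qk_integrable P n0 mJ J0 mtau h1_ge0 k h_0.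
have m1 : m <= 1.
  rewrite mE -[leRHS](Rintegral_prob_cst P); apply: le_Rintegral => //.
  - by apply: (@bounded_integrable _ _ _ _ _ `|1|).
  - by move=> w _; exact: qk_le1.
have iv : P.-integrable setT (EFin \o (fun w => k%:R * (8 * (qm (Kw (h + n%:R^-1) w) - qm
  (Kw h w))))).
  do 2 apply: Rintegral_scale_integrable.
  exact: (@integrableB _ _ _ _ _ _ _ _ (qm_integrable hn) (qm_integrable h_0)).
have id : P.-integrable setT (EFin \o (fun w => (qk k (Kw h w) - m) ^+ 2)).
  apply: (@bounded_integrable _ _ _ _ _ 1).
    apply: measurable_funX; apply: measurable_funB => //.
    by apply: measurable_qk => X; exact: measurable_Kw.
  by move=> w; apply: normr_sqr_dist_le1; rewrite ?m0// qk_ge0 ?qk_le1.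
have ivd : P.-integrable setT (EFin \o (fun w =>
    k%:R * (8 * (qm (Kw (h + n%:R^-1) w) - qm (Kw h w))) + (qk k (Kw h w) - m) ^+ 2)).
  exact: (@integrableD _ _ _ _ _ _ _ _ iv id).
have ivd' := Rintegral_scale_integrable (2 * eps)^-1 ivd.
have ic : P.-integrable setT (EFin \o (fun _ : T => eps / 2)).
  by apply: (@bounded_integrable _ _ _ _ _ `|eps / 2|).
have iM : P.-integrable setT (EFin \o (fun w => p%:R * (eps / 2 + (2 * eps)^-1 *
    (k%:R * (8 * (qm (Kw (h + n%:R^-1) w) - qm (Kw h w))) + (qk k (Kw h w) - m) ^+ 2)))).
  apply: Rintegral_scale_integrable.
  exact: (@integrableD _ _ _ _ _ _ _ _ ic ivd').
apply: (@le_trans _ _ (\int[P]_w (p%:R * (eps / 2 + (2 * eps)^-1 *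
    (k%:R * (8 * (qm (Kw (h + n%:R^-1) w) - qm (Kw h w))) + (qk k (Kw h w) - m) ^+
      2)))%:E)%E).
  apply: ge0_le_integral => //.
  - by move=> w _; rewrite lee_fin gibbs_ge0.
  - apply/measurable_EFinP; rewrite /gibbs.
    apply: measurable_sum => ss.
    under eq_fun do rewrite ZpartE.
    have -> : (fun w => (\prod_(j < k) gweight (J^~ w) (tau^~ w) h h1 (ss j)) *
       `|Qk R ss ^+ p - m ^+ p| / ZK (addh (fields (J^~ w) (fun i => (tau i w)%:R) h1) h)
         ^+ k) =
       (fun w => (\prod_(j < k) wK (Kw h w) (ss j)) *
       `|Qk R ss ^+ p - m ^+ p| * expR (- ln (ZK (Kw h w))) ^+ k).
      apply/funext => w; rewrite -exprVn expRN lnK ?posrE ?ZK_gt0//.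
      by congr (_ * _ * _); apply: eq_bigr => j _; rewrite gweightE.
    apply: measurable_funM.
      apply: measurable_funM => //; apply: measurable_prod => j _.
      by apply: measurable_wK => X; exact: measurable_Kw.
    apply: measurable_funX; apply: measurableT_comp; first exact: measurable_expR.
    apply: measurableT_comp => //; apply: measurableT_comp; first exact: measurable_ln.
    by apply: measurable_ZK => X; exact: measurable_Kw.
  - by case/integrableP: iM.
  - move=> w _; rewrite lee_fin.
    have m_1 : `|m| <= 1 by rewrite ger0_norm.
    apply: le_trans (gibbs_Qk_dev n0 k p (K0 w) m_1 e0) _.
    rewrite ler_wpM2l// lerD2l mulrC ler_wpM2l ?invr_ge0//.
    rewrite lerD2r ler_wpM2l//.
    have := vm_le n0 (Kw h w); rewrite KwD; exact.
have fK : (\int[P]_w (p%:R * (eps / 2 + (2 * eps)^-1 *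
    (k%:R * (8 * (qm (Kw (h + n%:R^-1) w) - qm (Kw h w))) + (qk k (Kw h w) - m) ^+
      2)))%:E)%E
   \is a fin_num by exact: integrable_fin_num iM.
rewrite -(fineK fK) lee_fin.
rewrite -[X in X <= _]/(Rintegral P setT _) RintegralZl//; last exact: (@integrableD _ _
  _ _ _ _ _ _ ic ivd').
rewrite ler_wpM2l// (RintegralD measurableT ic ivd') Rintegral_prob_cst lerD2l.
rewrite (RintegralZl _ measurableT ivd) mulrC ler_wpM2r ?invr_ge0//.
rewrite (RintegralD measurableT iv id) lerD//.
  have i1 : P.-integrable setT (EFin \o (fun w => qm (Kw (h + n%:R^-1) w) - qm (Kw h w))).
    exact: (@integrableB _ _ _ _ _ _ _ _ (qm_integrable hn) (qm_integrable h_0)).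
  rewrite (RintegralZl _ measurableT (Rintegral_scale_integrable 8 i1)).
  rewrite (RintegralZl _ measurableT i1).
  by rewrite (RintegralB measurableT (qm_integrable hn) (qm_integrable h_0)).
rewrite mE; apply: le_trans (var_qk_le n0 mJ J0 mtau ind h1_ge0 k0 h_0) _.
by rewrite ler_wpM2l ?sqr_ge0//; exact: var_qm_le.
Qed.

End Concentration.

Local Open Scope classical_set_scope.
Local Open Scope ring_scope.

(** * Product rule for functions of disjoint blocks of coordinates *)

Section IndependentBlocks.
Variables (R : realType) (I : finType) (d : measure_display) (T : measurableType d).
Variables (P : probability T R) (X : I -> T -> R).
Hypothesis mX : forall i, measurable_fun setT (X i).
Hypothesis indepX : forall B : I -> set R, (forall i, measurable (B i)) ->
  P (rect X B) = (\prod_i fine (P (X i @^-1` B i)))%:E.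
Variables (A : pred I) (u v : (I -> R) -> R).
Hypotheses (mu : coord_measurable u) (mv : coord_measurable v).
Hypotheses (u01 : forall x, 0 <= u x <= 1) (v01 : forall x, 0 <= v x <= 1).
Hypothesis uA : forall x y, (forall i, A i -> x i = y i) -> u x = u y.
Hypothesis vA : forall x y, (forall i, ~~ A i -> x i = y i) -> v x = v y.

(** Exchanging the two copies at the coordinates outside [A] preserves the law. Afterwards [u] reads
    only the first copy and [v] only the second, and the integral factorises. *)
Lemma Rintegral_indep : \int[P]_w (u (X ^~ w) * v (X ^~ w)) =
  (\int[P]_w u (X ^~ w)) * (\int[P]_w v (X ^~ w)).
Proof.
have muX : measurable_fun setT (fun w => u (X ^~ w)) by exact: mu.
have mvX : measurable_fun setT (fun w => v (X ^~ w)) by exact: mv.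
have u0 x : 0 <= u x by case/andP: (u01 x).
have v0 x : 0 <= v x by case/andP: (v01 x).
have u1 x : u x <= 1 by case/andP: (u01 x).
have v1 x : v x <= 1 by case/andP: (v01 x).
have iu : P.-integrable setT (EFin \o (fun w => u (X ^~ w))).
  by apply: (@bounded_integrable _ _ _ _ _ 1) => // w; rewrite ger0_norm.
have iv : P.-integrable setT (EFin \o (fun w => v (X ^~ w))).
  by apply: (@bounded_integrable _ _ _ _ _ 1) => // w; rewrite ger0_norm.
rewrite -Rintegral_prod//.
pose H (y : I * bool -> R) := u (fun i => y (i, false)) * v (fun i => y (i, false)).
have mH : coord_measurable H.
  by move=> d' T' Y mY; apply: measurable_funM; [apply: (mu (Y := fun j => Y (j,
    false)))|apply: (mv (Y := fun j => Y (j, false)))].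
have H0 y : 0 <= H y by rewrite /H mulr_ge0.
transitivity (\int[(P \x P)%E]_z (u (X ^~ z.1) * v (X ^~ z.1) * cst 1 z.2)).
  rewrite (@Rintegral_prod _ _ _ _ (fun w => u (X ^~ w) * v (X ^~ w)) (cst 1))//.
  - by rewrite [X in _ * X]Rintegral_prob_cst mulr1.
  - exact: measurable_funM.
  - by move=> w; rewrite mulr_ge0.
  - apply: (@bounded_integrable _ _ _ _ _ 1); first exact: measurable_funM.
    by move=> w; rewrite ger0_norm ?mulr_ge0// mulr_ile1.
  - by apply: (@bounded_integrable _ _ _ _ _ 1) => // w; rewrite normr1.
transitivity (\int[(P \x P)%E]_z H (mix X (fun ib => ib.2 (+) false) ^~ z)).
  by apply: eq_Rintegral => z _; rewrite /= mulr1.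
rewrite (eq_mix_integral mX indepX (fun=> false) (fun i => ~~ A i) mH H0).
apply: eq_Rintegral => z _; rewrite /H/=; congr (_ * _).
  by apply: uA => i Ai; rewrite /mix/= Ai.
by apply: vA => i Ai; rewrite /mix/= Ai.
Qed.

End IndependentBlocks.

(** * Measurability of the mean magnetisation in the Poisson parameter *)

Section PoissonMixture.
Variables (R : realType) (n : nat) (d : measure_display) (T : measurableType d).
Variables (P : probability T R) (J : {set 'I_n} -> T -> R) (h1 h : R).
Hypothesis n0 : (0 < n)%N.
Hypothesis mJ : forall X, measurable_fun setT (J X).
Hypothesis J0 : forall X w, 0 <= J X w.
Hypothesis h1_ge0 : 0 <= h1.
Hypothesis h_ge0 : 0 <= h.

Definition rqm (m : 'I_n -> nat) : R := rq P J (fun i _ => m i) h1 h.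

Definition pois (lam : R) (m : nat) : R := expR (- lam) * lam ^+ m / m`!%:R.

Section fixed_law.
Variables (tau : 'I_n -> T -> nat) (lam : R).
Hypothesis mtau : forall i (Y : set nat), measurable (tau i @^-1` Y).
Hypothesis ind : indep_family P J tau.
Hypothesis law : forall i, poisson_law P (tau i) lam.

Let below M w : R := ([forall i, tau i w < M]%N)%:R.

Let hit (m : 'I_n -> nat) (x : {set 'I_n} + 'I_n -> R) : R :=
  \prod_(i < n) \1_[set (m i)%:R] (x (inr i)).

Lemma Rintegral_hit m : \int[P]_w hit m (coords J tau ^~ w) = \prod_i pois lam (m i).
Proof.
pose E := [set w | (forall X, setT (J X w)) /\ (forall i, [set m i] (tau i w))].
have -> : \int[P]_w hit m (coords J tau ^~ w) = \int[P]_w \1_E w.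
  apply: eq_Rintegral => w _; rewrite indicE; have [wE|wE] := boolP (w \in E).
    rewrite /hit big1// => i _; rewrite indicE mem_set//.
    by move: wE; rewrite inE => -[_ /(_ i)] /= ->.
  have /existsP[i] : [exists i, tau i w != m i].
    apply: contraNT wE; rewrite negb_exists => /forallP wm; rewrite inE; split => // i.
    by have := wm i; rewrite negbK => /eqP.
  move=> im; rewrite /hit (bigD1 i)//= indicE memNset ?mul0r//=.
  by move/eqP; rewrite eqr_nat; exact/negP.
have mE : measurable E.
  have -> : E = \big[setI/setT]_(i : 'I_n) (tau i @^-1` [set m i]).
    apply/seteqP; split => w /=.
      move=> [_ h']; apply: (big_ind (fun A : set T => A w)); [by []|by move=> A A' ? ?;
        split|by move=> i _; exact: h'].
    by move=> h'; split=> // i; move: h'; rewrite (bigD1 i)//= => -[].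
  by apply: bigsetI_measurable.
rewrite /Rintegral integral_indic// setIT.
apply: etrans (congr1 fine (ind (B := fun=> setT) (fun i => [set m i]) (fun _ =>
  measurableT))) _ => /=.
rewrite big1 ?mul1r => [|X _]; last by rewrite preimage_setT probability_setT.
by apply: eq_bigr => i _; rewrite (law i (m i)).
Qed.

(** On the truncation event the vector [tau] takes finitely many values. Splitting by its value and
    using its independence from the couplings leaves a finite mixture in which [lam] enters only
    through the Poisson weights. *)
Lemma Rintegral_below M :
  \int[P]_w (qm (Kw J tau h1 h w) * below M w) =
  \sum_(m : {ffun 'I_n -> 'I_M}) (\prod_(i < n) pois lam (m i)) * rqm (fun i => m i).
Proof.
pose v (m : 'I_n -> nat) (x : {set 'I_n} + 'I_n -> R) : R := qm (addh (fields (fun X =>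
  `|x (inl X)|) (fun i => (m i)%:R) h1) h).
have v01 m x : 0 <= v m x <= 1.
  by rewrite qm_le1// andbT qm_ge0//; apply: addh_ge0 => //; exact: fields_ge0.
have mv m : coord_measurable (v m).
  move=> d' T' Y mY; apply: measurable_qm => X; apply: measurable_funD => //.
  by apply: measurable_funD => //; apply: measurableT_comp.
have hit01 m x : 0 <= hit m x <= 1.
  rewrite /hit; apply/andP; split; [apply: prodr_ge0|apply: prodr_ile1] => i _;
    by rewrite indicE; case: (_ \in _); rewrite /= ?lexx ?ler01.
have mhit m : coord_measurable (hit m).
  move=> d' T' Y mY; apply: measurable_prod => i _.
  by apply: measurableT_comp => //; exact: measurable_indic.
have mc := measurable_coords mJ mtau.
have ic := indep_coords ind.
have split_ m : \int[P]_w (hit m (coords J tau ^~ w) * v m (coords J tau ^~ w)) =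
    (\prod_(i < n) pois lam (m i)) * rqm m.
  pose A (i : {set 'I_n} + 'I_n) := if i is inr _ then true else false.
  have hitA x y : (forall i, A i -> x i = y i) -> hit m x = hit m y.
    by move=> xy; apply: eq_bigr => i _; rewrite xy.
  have vA x y : (forall i, ~~ A i -> x i = y i) -> v m x = v m y.
    move=> xy; rewrite /v.
    have -> : (fun X => `|x (inl X)|) = (fun X => `|y (inl X)|) by apply/funext => X;
      rewrite xy.
    by [].
  apply: etrans (Rintegral_indep mc ic (mhit m) (mv m) (hit01 m) (v01 m) hitA vA) _.
  apply: (congr2 *%R (Rintegral_hit m)); apply: eq_Rintegral => w _.
  rewrite /v /Kw.
  by have -> : (fun X => `|coords J tau (inl X) w|) = J ^~ w by apply/funext => X /=;
    rewrite ger0_norm.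
under eq_bigr do rewrite -split_.
have int m : P.-integrable setT (EFin \o (fun w => hit m (coords J tau ^~ w) * v m
  (coords J tau ^~ w))).
  apply: (@bounded_integrable _ _ _ _ _ 1).
    by apply: measurable_funM; [exact: mhit|exact: mv].
  move=> w; have /andP[a b] := hit01 m (coords J tau ^~ w).
  have /andP[a' b'] := v01 m (coords J tau ^~ w).
  by rewrite ger0_norm; [exact: mulr_ile1|exact: mulr_ge0].
have sumE (r : seq {ffun 'I_n -> 'I_M}) :
   \sum_(m <- r) \int[P]_w (hit (fun i => m i) (coords J tau ^~ w) * v (fun i => m i)
     (coords J tau ^~ w)) =
   \int[P]_w \sum_(m <- r) (hit (fun i => m i) (coords J tau ^~ w) * v (fun i => m i)
     (coords J tau ^~ w)).
  rewrite /Rintegral; under [in RHS]eq_integral do rewrite -sumEFin.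
  rewrite integral_sum//; last by move=> m; exact: int.
  by rewrite sum_fine// => m _; exact: integrable_fin_num (int _).
rewrite sumE; apply: eq_Rintegral => w _.
have hitE m : hit m (coords J tau ^~ w) = (m == (fun i => tau i w) :> ('I_n -> nat))%:R.
  rewrite /hit; have [->|mt] := eqVneq m (fun i => tau i w).
    by rewrite big1// => i _; rewrite indicE mem_set.
  have /existsP[i] : [exists i, tau i w != m i].
    apply: contra_neqT mt; rewrite negb_exists => /forallP wm; apply/funext => i.
    by have := wm i; rewrite negbK => /eqP.
  move=> im; rewrite (bigD1 i)//= indicE memNset ?mul0r//=.
  by move/eqP; rewrite eqr_nat; exact/negP.
rewrite /below; case: (boolP [forall i, tau i w < M]%N) => [/forallP tM|/forallPn[i tM]].
  pose m0 : {ffun 'I_n -> 'I_M} := [ffun i => Ordinal (tM i)].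
  have m0E : (fun i => m0 i : nat) = (fun i => tau i w) by apply/funext => i; rewrite ffunE.
  rewrite mulr1 (bigD1 m0)//= hitE m0E eqxx mul1r big1 ?addr0.
    rewrite /v /Kw.
    by have -> : (fun X => `|coords J tau (inl X) w|) = J ^~ w by apply/funext => X /=;
      rewrite ger0_norm.
  move=> m mm0; rewrite hitE; case: eqP => [mE|]; last by rewrite mul0r.
  case/eqP: mm0; apply/ffunP => i; apply/val_inj.
  by rewrite -[LHS]/((fun i => m i : nat) i) mE ffunE.
rewrite mulr0 big1// => m _; rewrite hitE; case: eqP => [mE|]; last by rewrite mul0r.
case/negP: tM; rewrite -[X in (X < _)%N]/((fun i => tau i w) i) -mE; exact: ltn_ord.
Qed.

(** Dominated convergence with bound 1: for each [w] the truncation is inactive once [M] exceeds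
    every [tau i w]. *)
Lemma cvg_below :
  (\int[P]_w (qm (Kw J tau h1 h w) * below M w))%:E @[M --> \oo] --> (rq P J tau h1 h)%:E.
Proof.
have mb M : measurable_fun setT (below M).
  have -> : below M = \1_(\big[setI/setT]_(i : 'I_n) (tau i @^-1` [set j | (j < M)%N])).
    apply/funext => w; rewrite /below indicE; congr (nat_of_bool _)%:R.
    apply/idP/idP => [/forallP tM|].
      rewrite inE; apply: (big_ind (fun A : set T => A w)); [by []|by move=> A A' ? ?;
        split|by move=> i _; exact: tM].
    by rewrite inE => h'; apply/forallP => i; move: h'; rewrite (bigD1 i)//= => -[].
  by apply: measurable_indic; apply: bigsetI_measurable.
have mK X : measurable_fun setT (fun w => Kw J tau h1 h w X) by exact: measurable_Kw.
have q0 w : 0 <= qm (Kw J tau h1 h w) by apply: qm_ge0; exact: Kw_ge0.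
have q1 w : qm (Kw J tau h1 h w) <= 1 by exact: qm_le1.
have mqb M : measurable_fun setT (fun w => qm (Kw J tau h1 h w) * below M w).
  by apply: measurable_funM => //; exact: measurable_qm.
have b01 M w : 0 <= below M w <= 1 by rewrite /below; case: [forall i, _]; rewrite /=
  ?lexx ?ler01.
pose F M w := (qm (Kw J tau h1 h w) * below M w)%:E.
pose G w := (qm (Kw J tau h1 h w))%:E.
have mF M : measurable_fun setT (F M) by exact/measurable_EFinP.
have mG : measurable_fun setT G by apply/measurable_EFinP; exact: measurable_qm.
have FG : {ae P, forall w, setT w -> F M w @[M --> \oo] --> G w}.
  apply: aeW => w _; apply: cvg_near_cst.
  exists (\max_(i < n) tau i w).+1 => // M /= ltM; rewrite /F /G /below.
  have -> : [forall i, tau i w < M]%N by apply/forallP => i; apply: leq_ltn_trans ltM;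
    exact: leq_bigmax.
  by rewrite mulr1.
have Fb M w : `|qm (Kw J tau h1 h w) * below M w| <= 1.
  have /andP[a b] := b01 M w; rewrite ger0_norm; [exact: mulr_ile1|exact: mulr_ge0].
have i1 : P.-integrable setT (cst 1%E : T -> \bar R).
  by apply: (@bounded_integrable _ _ _ _ (cst 1) 1) => // w; rewrite normr1.
have F1 : {ae P, forall w M, setT w -> (`|F M w| <= cst 1%E w)%E}.
  by apply: aeW => w M _; rewrite /= lee_fin.
have [_ _] := dominated_convergence measurableT mF mG FG i1 F1.
have -> : [sequence (\int[P]_(x in setT) F M x)%E]_M =
    (fun M => (\int[P]_w (qm (Kw J tau h1 h w) * below M w))%:E).
  apply/funext => M /=; rewrite /Rintegral fineK//.
  apply: integrable_fin_num => //; exact: (@bounded_integrable _ _ _ _ _ 1).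
rewrite /rq /Rintegral fineK//.
apply: integrable_fin_num => //; apply: (@bounded_integrable _ _ _ _ _ 1) => [|w].
  exact: measurable_qm.
by rewrite ger0_norm.
Qed.

End fixed_law.

(** Nothing is known of [tau a w] as a function of [a], so measurability has to come from the law:
    the mean is a pointwise limit of finite mixtures with explicit measurable weights. *)
Lemma measurable_rq (tau : R -> 'I_n -> T -> nat) (L : R) (D : set R) :
  measurable D ->
  (forall a i Y, D a -> measurable (tau a i @^-1` Y)) ->
  (forall a, D a -> indep_family P J (tau a)) ->
  (forall a i, D a -> poisson_law P (tau a i) (a * L)) ->
  measurable_fun D (fun a => rq P J (tau a) h1 h).
Proof.
move=> mD mtau ind law; apply/measurable_EFinP.
pose s M a : \bar R := (\sum_(m : {ffun 'I_n -> 'I_M}) (\prod_(i < n) pois (a * L) (m i))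
  * rqm (fun i => m i))%:E.
apply: (@emeasurable_fun_cvg _ _ _ _ s) => //.
- move=> M; apply/measurable_EFinP; apply: measurable_sum => m.
  apply: measurable_funM => //; apply: measurable_prod => i _.
  apply: measurable_funM => //; apply: measurable_funM; last first.
    by apply: measurable_funX; apply: measurable_funM.
  apply: measurableT_comp; first exact: measurable_expR.
  by apply: measurableT_comp => //; apply: measurable_funM.
- move=> a Da; rewrite /s /=.
  under eq_fun do rewrite -(Rintegral_below (fun i Y => mtau a i Y Da) (ind a Da) (fun i
    => law a i Da)).
  exact: cvg_below (fun i Y => mtau a i Y Da) .
Qed.

End PoissonMixture.

(** * Integration over the parameters *)

(* The integral of a nonnegative function is a supremum over the simple functions
   below it, whether or not the function is measurable. *)
Lemma ge0_le_lower_integral d (T : measurableType d) (R : realType)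
    (mu : {measure set T -> \bar R}) (D : set T) (f g : T -> \bar R) :
  (forall x, D x -> (0 <= f x)%E) -> (forall x, D x -> (f x <= g x)%E) ->
  (\int[mu]_(x in D) f x <= \int[mu]_(x in D) g x)%E.
Proof.
move=> f0 fg; rewrite !ge0_integralE//; last by move=> x Dx; exact: le_trans (f0 x Dx)
  (fg x Dx).
apply: le_ereal_sup => _ [h hf <-]; exists h => // x; apply: le_trans (hf x) _.
by rewrite /patch; case: ifPn => // /set_mem Dx; exact: fg.
Qed.

(** * Integrated increments of a monotone function *)

Section Grid.
Variables (R : realType) (rho : R -> R) (lo hi del : R).
Hypotheses (lohi : lo <= hi) (del0 : 0 < del) (dlo : del <= lo).
Hypothesis rho01 : forall x, 0 <= x -> 0 <= rho x <= 1.
Hypothesis rho_mono : forall x y, 0 <= x -> x <= y -> rho x <= rho y.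
Local Notation mu := (@lebesgue_measure R).

Lemma telescope3 (y : nat -> R) M :
  \sum_(j < M) (y j.+3 - y j) = y M + y M.+1 + y M.+2 - (y 0 + y 1 + y 2).
Proof.
by elim: M => [|M IH]; rewrite ?big_ord0 ?big_ord_recr /= ?IH; ring.
Qed.

(** For [h] in the cell from [x j] to [x j.+1], the window of radius [del] around [h] lies between
    [x j - del] and [x j + 2 del], the sampling points of [y j] and [y j.+3]. The resulting step
    function is a measurable majorant. Its increments telescope to three end terms minus three
    initial ones, at most 3 in all. *)
Lemma integral_shift_le c B : 0 <= c -> 0 <= B ->
  (\int[mu]_(h in `[lo, hi]) (c + B * (rho (h + del) - rho (h - del)))%:E <=
   (c * (hi - lo) + 3 * B * del)%:E)%E.
Proof.
move=> c0 B0.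
pose y j := rho (lo + j%:R * del - del).
pose x j := lo + j%:R * del.
have lo0 : 0 <= lo by exact: le_trans (ltW del0) dlo.
have x0 j : 0 <= x j - del.
  by rewrite /x addrAC addr_ge0 ?subr_ge0// mulr_ge0// ltW.
have cj j : 0 <= y j.+3 - y j.
  rewrite subr_ge0; apply: rho_mono; first exact: x0.
  by rewrite lerD2r lerD2l ler_pM2r// ler_nat -addn3 leq_addr.
(* The successor accounts for the last cell, the one containing [hi]. *)
pose M := (Num.trunc ((hi - lo) / del)).+1.
pose A j := `[x j, x j.+1[%classic : set R.
have mA j : measurable (A j) by exact: measurable_itv.
have le1 h : `[lo, hi]%classic h ->
   ((c + B * (rho (h + del) - rho (h - del)))%:E <=
   c%:E + \sum_(j < M) (B * (y j.+3 - y j) * \1_(A j) h)%:E)%E.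
  rewrite /= in_itv/= => /andP[lh hh].
  pose j := Num.trunc ((h - lo) / del).
  have hd0 : 0 <= (h - lo) / del by rewrite divr_ge0 ?subr_ge0// ltW.
  have /andP[j1 j2] := truncn_itv hd0; rewrite -/j in j1 j2.
  have xj : x j <= h by rewrite /x -lerBrDl -ler_pdivlMr.
  have xj1 : h < x j.+1 by rewrite /x -ltrBlDl -ltr_pdivrMr.
  have jM : (j < M)%N.
    rewrite ltnS; apply: le_truncn.
    by rewrite ler_pM2r ?invr_gt0// lerD2r.
  rewrite sumEFin -EFinD lee_fin lerD2l (bigD1 (Ordinal jM))//= indicE mem_set ?mulr1;
    last first.
    by rewrite /A /= in_itv/= xj xj1.
  rewrite ler_wpDr//.
    by apply: sumr_ge0 => i _; rewrite !mulr_ge0.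
  rewrite ler_wpM2l// lerB//; apply: rho_mono.
  - by rewrite addr_ge0// ?(le_trans lo0 lh)// ltW.
  - have -> : lo + j.+3%:R * del - del = x j.+1 + del by rewrite /x -!natr1; ring.
    by rewrite lerD2r ltW.
  - exact: x0.
  - by rewrite lerD2r.
have yd h : `[lo, hi]%classic h -> 0 <= rho (h + del) - rho (h - del).
  rewrite /= in_itv/= => /andP[lh hh]; rewrite subr_ge0; apply: rho_mono.
    by rewrite subr_ge0 (le_trans dlo).
  by rewrite lerD2l (le_trans _ (ltW del0))// oppr_le0 ltW.
apply: (@le_trans _ _ (\int[mu]_(h in `[lo, hi]) (c%:E + \sum_(j < M) (B * (y j.+3 - y j)
  * \1_(A j) h)%:E))%E).
  apply: ge0_le_lower_integral => // h hh.
  by rewrite lee_fin addr_ge0// mulr_ge0// yd.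
have mS j : measurable_fun `[lo, hi]%classic (fun h => (B * (y j.+3 - y j) * \1_(A j)
  h)%:E).
  by apply/measurable_EFinP; apply: measurable_funM => //; exact: measurable_indic.
have S0 (j : 'I_M) h : `[lo, hi]%classic h -> (0 <= (B * (y j.+3 - y j) * \1_(A j) h)%:E)%E.
  by move=> _; rewrite lee_fin !mulr_ge0.
rewrite ge0_integralD//=; last 2 first.
- by move=> h hh; apply: sume_ge0 => j _; exact: S0.
- by apply: emeasurable_sum => j; exact: mS.
have ic : (\int[mu]_(h in `[lo, hi]) c%:E = c%:E * mu `[lo, hi]%classic)%E by exact:
  integral_cst.
rewrite EFinD; apply: leeD.
  rewrite ic lebesgue_measure_itv/=.
  rewrite EFinM; apply: lee_wpmul2l; first by rewrite lee_fin.
  case: ifPn => // _.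
  by rewrite lee_fin subr_ge0.
apply: (@le_trans _ _ (\sum_(j < M) (B * (y j.+3 - y j) * del)%:E)%E).
  rewrite (@ge0_integral_sum _ _ _ mu `[lo, hi]%classic _ 'I_M
    (fun j h => (B * (y j.+3 - y j) * \1_(A j) h)%:E)); first last.
  - exact: S0.
  - by move=> j; exact: mS.
  - exact: measurable_itv.
  apply: lee_sum => j _.
  under eq_integral do rewrite EFinM.
  rewrite ge0_integralZl_EFin//; last 2 first.
  - have m1 : measurable_fun `[lo, hi]%classic (\1_(A j) : R -> R) by exact:
    measurable_indic.
    exact/measurable_EFinP.
  - by rewrite mulr_ge0.
  have -> : (B * (y j.+3 - y j) * del)%:E = ((B * (y j.+3 - y j))%:E * del%:E)%E by
    rewrite EFinM.
  apply: lee_wpmul2l; first by rewrite lee_fin mulr_ge0.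
  have -> : (\int[mu]_(h in `[lo, hi]) (\1_(A j) h)%:E = mu (A j `&` `[lo, hi]))%E.
    by apply: integral_indic; [exact: measurable_itv|exact: mA].
  apply: (@le_trans _ _ (mu (A j))); first by apply: le_measure; rewrite ?inE; [apply:
    measurableI; [exact: mA|exact: measurable_itv]|exact: mA|exact: subIsetl].
  rewrite lebesgue_measure_itv/= lte_fin; case: ifPn => _; last by rewrite lee_fin ltW.
  by rewrite -EFinB lee_fin /x -natr1; lra.
rewrite sumEFin lee_fin -mulr_suml -mulr_sumr telescope3.
apply: ler_wpM2r; first exact: ltW.
rewrite mulrC; apply: ler_wpM2r => //.
have y01 j : 0 <= y j <= 1 by apply: rho01; exact: x0.
move: (y01 0) (y01 1) (y01 2) (y01 M) (y01 M.+1) (y01 M.+2).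
move: (y 0) (y 1) (y 2) (y M) (y M.+1) (y M.+2) => y0 y1 y2 y3 y4 y5.
lra.
Qed.
End Grid.

(** * The bound integrated over the field and the Poisson parameter *)

Section IntegratedBound.
Variables (R : realType) (n : nat) (d : measure_display) (T : measurableType d).
Variables (P : probability T R) (J : {set 'I_n} -> T -> R) (tau : R -> 'I_n -> T -> nat).
Variables (h1 L v del eps lo hi alo ahi : R) (k p : nat).
Hypothesis n0 : (0 < n)%N.
Hypothesis mJ : forall X, measurable_fun setT (J X).
Hypothesis J0 : forall X w, 0 <= J X w.
Hypothesis h1_ge0 : 0 <= h1.
Hypothesis mtau : forall a i (Y : set nat), 0 < a < 1 -> measurable (tau a i @^-1` Y).
Hypothesis law : forall a i, 0 < a < 1 -> poisson_law P (tau a i) (a * L).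
Hypothesis ind : forall a, 0 < a < 1 -> indep_family P J (tau a).
Hypothesis V : forall u a, 0 < u < 1 -> 0 < a < 1 ->
  (Var P (fun w => Pm (Kw J (tau a) h1 u w)) <= v%:E)%E.
Hypotheses (lohi : lo <= hi) (lo1 : hi - lo <= 1) (alo0 : 0 < alo) (aa : alo <= ahi)
  (ahi1 : ahi < 1).
Hypotheses (k0 : (0 < k)%N) (eps0 : 0 < eps) (del0 : 0 < del) (dlo : del < lo) (dhi : hi
  + del < 1).
Hypotheses (ndel : n%:R^-1 <= del) (v0 : 0 <= v).

Local Notation mu := (@lebesgue_measure R).
Local Notation D := (`[alo, ahi]%classic : set R).
Local Notation r a x := (rq P J (tau a) h1 x).

Let aD a : D a -> 0 < a < 1.
Proof. by rewrite /= in_itv/= => /andP[a1 a2]; rewrite (lt_le_trans alo0 a1) (le_lt_trans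
  a2 ahi1). Qed.

Let mD : measurable D. Proof. exact: measurable_itv. Qed.

Let muD : (mu D < +oo)%E /\ 0 <= fine (mu D) <= 1.
Proof.
rewrite lebesgue_measure_itv/=; case: ifPn => _; last by rewrite ltry/= lexx ler01.
by rewrite -EFinB ltry/= subr_ge0 aa/=; split=> //; move: alo0 ahi1; lra.
Qed.

Let r01 a x : D a -> 0 <= x -> 0 <= r a x <= 1.
Proof.
move=> Da x0; have mt i Y := mtau i Y (aD Da).
by apply/andP; split; [exact: rq_ge0|exact: rq_le1].
Qed.

Let D_integrable (f : R -> R) c : measurable_fun D f -> (forall a, D a -> `|f a| <= c) ->
  mu.-integrable D (EFin \o f).
Proof.
move=> mf fc; apply: measurable_bounded_integrable => //; first exact: muD.1.
exists c; split; first exact: num_real.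
by move=> M cM a Da; exact: le_trans (fc a Da) (ltW cM).
Qed.

Let mr x : 0 <= x -> measurable_fun D (fun a => r a x).
Proof.
move=> x0; apply: (@measurable_rq _ _ _ _ _ _ h1 x n0 mJ J0 h1_ge0 x0 tau L) => //.
- by move=> a i Y /aD; exact: mtau.
- by move=> a /aD; exact: ind.
- by move=> a i /aD; exact: law.
Qed.

Let ir x : 0 <= x -> mu.-integrable D (EFin \o (fun a => r a x)).
Proof.
move=> x0; apply: (D_integrable (c := 1)); first exact: mr.
by move=> a Da; have /andP[r0 r1] := r01 Da x0; rewrite ger0_norm.
Qed.

(** Averaging over [alpha] leaves one function of the field, still monotone and, as the
    [alpha]-interval is shorter than 1, still with values in [0, 1]: the input of the grid
    estimate. *)
Definition rho x : R := \int[mu]_(a in D) r a x.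

Let rho01 x : 0 <= x -> 0 <= rho x <= 1.
Proof.
move=> x0; apply/andP; split.
  by apply: Rintegral_ge0 => a Da; case/andP: (r01 Da x0).
apply: (@le_trans _ _ (\int[mu]_(a in D) 1)).
  apply: le_Rintegral => //; first exact: ir.
    by apply: (D_integrable (c := 1)) => // a _; rewrite normr1.
  by move=> a Da; case/andP: (r01 Da x0).
by rewrite Rintegral_cst// mul1r; case/andP: muD.2.
Qed.

Let rho_mono x y : 0 <= x -> x <= y -> rho x <= rho y.
Proof.
move=> x0 xy; apply: le_Rintegral; [exact: measurable_itv|exact: ir|apply: ir; exact:
  le_trans xy|].
by move=> a Da; apply: rq_mono => // i Y; apply: mtau; exact: aD.
Qed.

Definition bound_cst : R := p%:R * (eps / 2 + k%:R ^+ 2 * (18 * v / del ^+ 2) / (2 * eps)).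
(** Coefficient of the increment of [r] over the window: [8 k] comes from the thermal variance,
    [2 k^2] from the disorder variance. *)
Definition bound_slope : R := p%:R * ((8 * k%:R + 2 * k%:R ^+ 2) / (2 * eps)).

Let bound_cst_ge0 : 0 <= bound_cst.
Proof.
have e0 := ltW eps0.
apply: mulr_ge0 => //; apply: addr_ge0; first exact: divr_ge0.
apply: divr_ge0; last exact: mulr_ge0.
apply: mulr_ge0; first exact: sqr_ge0.
by apply: divr_ge0; [exact: mulr_ge0|exact: sqr_ge0].
Qed.

Let bound_slope_ge0 : 0 <= bound_slope.
Proof.
have e0 := ltW eps0.
apply: mulr_ge0 => //; apply: divr_ge0; last exact: mulr_ge0.
by apply: addr_ge0; apply: mulr_ge0 => //; exact: sqr_ge0.
Qed.

Let dev h a : R -> T -> R := fun m w =>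
  gibbs (J ^~ w) (tau a ^~ w) h h1 (fun ss => (`| (@Qk R n k ss) ^+ p - m ^+ p |)%R).

Let mean h a := fine (Ex P (fun w => gibbs (J ^~ w) (tau a ^~ w) h h1 (@Qk R n k))).

Let dev_le h a : lo <= h <= hi -> D a ->
  (Ex P (dev h a (mean h a)) <= (bound_cst + bound_slope * (r a (h + del) - r a (h -
    del)))%:E)%E.
Proof.
move=> /andP[lh hh] Da; have a01 := aD Da.
have mt i Y := mtau i Y a01.
have hd : 0 <= h - del by move: dlo; lra.
have hd1 : 0 < h - del by move: dlo; lra.
have hp1 : h + del < 1 by move: dhi; lra.
have hb : 0 < h < 1 by move: del0; lra.
apply: le_trans (Ex_gibbs_dev n0 mJ J0 mt (ind a01) h1_ge0 p k0 eps0 del0 hd (v := v) _) _.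
  move=> u; rewrite !inE => /or3P[]/eqP ->; apply: V => //; move: del0; lra.
rewrite lee_fin /bound_cst /bound_slope -(mulrA p%:R) -mulrDr; apply: ler_wpM2l => //.
have h0 : 0 <= h by case/andP: hb => /ltW.
have hn : 0 <= h + n%:R^-1 by rewrite addr_ge0.
(* Since [1/n <= del], the thermal increment is contained in the window already used for the
   disorder, and one increment serves both. *)
have m1 : r a (h + n%:R^-1) <= r a (h + del) by apply: rq_mono => //; rewrite lerD2l.
have hd' : h - del <= h by rewrite gerBl ltW.
have m2 : r a (h - del) <= r a h by apply: rq_mono.
have k1 : (0 : R) <= k%:R by [].
move: m1 m2; move: (r a _) (r a _) (r a _) (r a _) => z t y x m1 m2.
have e2 : 0 <= (2 * eps)^-1 by rewrite invr_ge0 mulr_ge0// ltW.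
have kk : k%:R * (8 * (x - z)) <= k%:R * (8 * (y - t)).
  apply: ler_wpM2l => //. lra.
rewrite -addrA lerD2l.
have -> : k%:R ^+ 2 * (18 * v / del ^+ 2) / (2 * eps) + (8 * k%:R + 2 * k%:R ^+ 2) / (2 *
  eps) * (y - t)
  = (k%:R * (8 * (y - t)) + k%:R ^+ 2 * (18 * v / del ^+ 2 + 2 * (y - t))) / (2 * eps) by
    ring.
by apply: ler_wpM2r => //; rewrite lerD2r.
Qed.

Let inner_le h : lo <= h <= hi ->
  (\int[mu]_(a in D) Ex P (dev h a (mean h a)) <=
  (bound_cst + bound_slope * (rho (h + del) - rho (h - del)))%:E)%E.
Proof.
move=> hh; have /andP[lh hh'] := hh.
have hp : 0 <= h + del by move: dlo del0; lra.
have hm : 0 <= h - del by move: dlo; lra.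
apply: (@le_trans _ _ (\int[mu]_(a in D) (bound_cst + bound_slope * (r a (h + del) - r a
  (h - del)))%:E)%E).
  (* This comparison requires no measurability of the deviation in [alpha]; the majorant is
     measurable and is integrated exactly below. *)
  apply: ge0_le_lower_integral => a Da; last exact: dev_le.
  by apply: integral_ge0 => w _; rewrite lee_fin gibbs_ge0.
have mB : measurable_fun D (fun a => r a (h + del) - r a (h - del)).
  by apply: measurable_funB; exact: mr.
have B1 a : D a -> `|r a (h + del) - r a (h - del)| <= 1.
  move=> Da; have := r01 Da hp; have := r01 Da hm; rewrite ler_norml.
  by move: (r a _) (r a _) => x y; lra.
have iB : mu.-integrable D (EFin \o (fun a => r a (h + del) - r a (h - del))).
  exact: D_integrable mB B1.
have iS : mu.-integrable D (EFin \o (fun a => bound_slope * (r a (h + del) - r a (h -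
  del)))).
  apply: (D_integrable (c := bound_slope)); first exact: measurable_funM.
  by move=> a Da; rewrite normrM ger0_norm// ler_piMr// B1.
have ic : mu.-integrable D (EFin \o (fun _ : R => bound_cst)).
  by apply: (D_integrable (c := `|bound_cst|)).
have iT : mu.-integrable D (EFin \o (fun a => bound_cst + bound_slope * (r a (h + del) -
  r a (h - del)))).
  apply: (D_integrable (c := bound_cst + bound_slope)).
    by apply: measurable_funD => //; exact: measurable_funM.
  move=> a Da; apply: le_trans (ler_normD _ _) _; rewrite ger0_norm// lerD2l.
  by rewrite normrM ger0_norm// ler_piMr// B1.
rewrite -[leLHS]fineK; last exact: integrable_fin_num iT.
rewrite lee_fin -[leLHS]/(Rintegral mu D _) (RintegralD _ ic iS)//.
rewrite (RintegralZl _ _ iB)// (RintegralB _ (ir hp) (ir hm))// lerD2r Rintegral_cst//.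
by rewrite ler_piMr//; case/andP: muD.2.
Qed.

Lemma integrated_bound :
  (\int[mu]_(h in `[lo, hi]) \int[mu]_(a in D) Ex P (dev h a (mean h a)) <=
   (bound_cst + 3 * bound_slope * del)%:E)%E.
Proof.
apply: (@le_trans _ _ (\int[mu]_(h in `[lo, hi]) (bound_cst + bound_slope * (rho (h +
  del) - rho (h - del)))%:E)%E).
  apply: ge0_le_lower_integral => h; rewrite /= in_itv/= => hh.
    apply: integral_ge0 => a _; apply: integral_ge0 => w _.
    by rewrite lee_fin gibbs_ge0.
  exact: inner_le.
apply: le_trans (integral_shift_le lohi del0 (ltW dlo) rho01 rho_mono bound_cst_ge0
  bound_slope_ge0) _.
by rewrite lee_fin lerD2r ler_piMr.
Qed.

End IntegratedBound.

(** * Choice of the scales and comparison of the rates *)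

Lemma exists_eta (R : realType) (t : R) : 0 < t -> exists N : nat, forall n, (N <= n)%N ->
  (0 < n)%N /\ 0 < (n%:R : R) `^ (- (1 / 16)) <= t.
Proof.
move=> t0; exists (Num.trunc ((t^-1) ^+ 16)).+1 => n Nn.
have n0 : (0 < n)%N by exact: leq_trans Nn.
have nR : (0 : R) < n%:R by rewrite ltr0n.
split => //; rewrite powR_gt0//=.
rewrite -(@ler_pXn2r _ 16)// ?nnegrE ?powR_ge0 ?(ltW t0)//.
rewrite -powR_mulrn ?powR_ge0// -powRrM.
have -> : - (1 / 16) * 16 = -1 :> R by field.
rewrite powRN powRr1// -[leRHS]invrK lef_pV2 ?posrE ?invr_gt0 ?exprn_gt0//.
rewrite -exprVn ltW//.
have ti : 0 <= t^-1 by rewrite invr_ge0 ltW.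
have /andP[_ t2] := truncn_itv (exprn_ge0 16 ti).
by apply: lt_le_trans t2 _; rewrite ler_nat.
Qed.

(** The substitution is [v = CP / n], [del = eta^4], [eps = eta^2] with [1/n = eta^16]. The pressure
    term is of order [eta^6] and is enlarged to [eta^2], the order of the other two. *)
Lemma bound_le_eta (R : realType) (eta CP : R) (k p : nat) : 0 < eta <= 1 -> 0 <= CP ->
  bound_cst (CP * eta ^+ 16) (eta ^+ 4) (eta ^+ 2) k p + 3 * bound_slope (eta ^+ 2) k p *
    eta ^+ 4 <=
  p%:R * (1 / 2 + 9 * k%:R ^+ 2 * CP + 12 * k%:R + 3 * k%:R ^+ 2) * eta ^+ 2.
Proof.
move=> /andP[e0 e1] C0; rewrite /bound_cst /bound_slope.
have -> : p%:R * (eta ^+ 2 / 2 + k%:R ^+ 2 * (18 * (CP * eta ^+ 16) / (eta ^+ 4) ^+ 2) /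
  (2 * eta ^+ 2)) +
   3 * (p%:R * ((8 * k%:R + 2 * k%:R ^+ 2) / (2 * eta ^+ 2))) * eta ^+ 4 =
   p%:R * ((1 / 2 + 9 * k%:R ^+ 2 * CP * eta ^+ 4 + 12 * k%:R + 3 * k%:R ^+ 2) * eta ^+ 2).
  by field; rewrite gt_eqF.
rewrite -(mulrA p%:R); apply: ler_wpM2l => //.
apply: ler_wpM2r; first by rewrite exprn_ge0// ltW.
rewrite !lerD2r lerD2l.
by rewrite ler_piMr ?exprn_ile1 ?(ltW e0)// mulr_ge0// mulr_ge0// sqr_ge0.
Qed.

Lemma tanh_gt0 (R : realType) (x : R) : 0 < x -> 0 < tanh x.
Proof.
move=> x0; apply: divr_gt0; last by rewrite addr_gt0// expR_gt0.
by rewrite subr_gt0 ltr_expR (lt_trans _ x0)// oppr_lt0.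
Qed.

Theorem theorem3p8 (R : realType) (d : measure_display)
  (T : nat -> measurableType d) (P : forall n, probability (T n) R)
  (J : forall n, {set 'I_n} -> T n -> R)
  (tau : forall n, R -> 'I_n -> T n -> nat)
  (theta hlo hhi alo ahi h1 C CP : R) (k p : nat) :
  1 / 2 < theta -> theta <= 7 / 8 ->
  0 < hlo -> hlo <= hhi -> hhi < 1 ->
  0 < alo -> alo <= ahi -> ahi < 1 ->
  0 < h1 -> h1 <= 1 ->
  (1 <= k)%N -> (2 <= p)%N ->
  (* couplings: measurable, nonnegative, finite second moments *)
  (forall n X, measurable_fun setT (J n X)) ->
  (forall n X w, 0 <= J n X w) ->
  (forall n X, (P n).-integrable setT (fun w => ((J n X w) ^+ 2)%:E)) ->
  (forall n, (0 < n)%N ->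
     (\sum_(X : {set 'I_n}) fine (Var (P n) (J n X)) <= C * n%:R)) ->
  (* tau_i i.i.d. Poisson(alpha n^(theta-1)), independent of the couplings *)
  (forall n a i (Y : set nat), 0 < a < 1 -> measurable (tau n a i @^-1` Y)) ->
  (forall n a i, 0 < a < 1 ->
     poisson_law (P n) (tau n a i) (a * (n%:R `^ (theta - 1)))) ->
  (forall n a, 0 < a < 1 -> indep_family (P n) (J n) (tau n a)) ->
  (* concentration of the pressure *)
  0 < CP ->
  (forall n h0 h1' a, (0 < n)%N -> 0 < h0 < 1 -> 0 < h1' <= 1 -> 0 < a < 1 ->
     (Var (P n) (fun w => Pn (J n ^~ w) (tau n a ^~ w) h0 h1')
        <= (CP / n%:R)%:E)%E) ->
  exists N : nat, forall n : nat, (N <= n)%N ->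
    (\int[lebesgue_measure]_(h0 in `[hlo, hhi])
       \int[lebesgue_measure]_(a in `[alo, ahi])
         (let m := fine (Ex (P n) (fun w =>
                     gibbs (J n ^~ w) (tau n a ^~ w) h0 h1 (@Qk R n k))) in
          Ex (P n) (fun w =>
            gibbs (J n ^~ w) (tau n a ^~ w) h0 h1
              (fun ss => (`| (@Qk R n k ss) ^+ p - m ^+ p |)%R)))
     <= ((2 * p%:R * k%:R) / (tanh h1 `^ (k%:R / 2))
           * ((5 * CP + 40) `^ (1 / 4)) / (n%:R `^ ((theta - 1 / 2) / 6)))%R%:E)%E.
Proof.
move=> th1 th2 lo0 lohi hi1 alo0 aa ahi1 h10 h11 k0 p2 mJ J0 _ _ mtau law ind CP0 conc.
set rate := _ / (tanh h1 `^ _) * _.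
have p0 : (0 : R) < p%:R by rewrite ltr0n; exact: leq_trans p2.
have kR : (0 : R) < k%:R by rewrite ltr0n.
have rate0 : 0 < rate.
  rewrite /rate mulr_gt0 ?divr_gt0 ?mulr_gt0 ?powR_gt0 ?tanh_gt0//.
  by rewrite addr_gt0// mulr_gt0.
pose A : R := p%:R * (1 / 2 + 9 * k%:R ^+ 2 * CP + 12 * k%:R + 3 * k%:R ^+ 2).
have A0 : 0 < A.
  by rewrite mulr_gt0// !addr_gt0// ?mulr_gt0 ?exprn_gt0.
(* The first two bounds keep the window of radius [eta^4] around each field inside (0, 1), where
   concentration is assumed; the third makes powers of [eta] decrease; the last gives
   [A eta^2 <= rate * eta]. *)
pose t := Num.min (hlo / 2) (Num.min ((1 - hhi) / 2) (Num.min 1 (rate / A))).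
have t0 : 0 < t by rewrite !lt_min !divr_gt0 ?subr_gt0 ?ltr01.
have [N NP] := exists_eta t0; exists N => n /NP[n0].
set eta := _ `^ _; rewrite !le_min => /andP[e0 /and4P[e1 e2 e3 e4]].
have e01 : 0 < eta <= 1 by rewrite e0.
have eX m : eta ^+ m.+1 <= eta by rewrite exprS ler_piMr ?exprn_ile1 ?(ltW e0).
have nE : n%:R^-1 = eta ^+ 16.
  rewrite -powR_mulrn ?(ltW e0)// -powRrM.
  have -> : - (1 / 16) * 16 = -1 :> R by field.
  by rewrite powRN powRr1.
have del0 : 0 < eta ^+ 4 by rewrite exprn_gt0.
have dlo : eta ^+ 4 < hlo.
  by apply: le_lt_trans (le_trans (eX 3) e1) _; rewrite ltr_pdivrMr// ltr_pMr// ltr1n.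
have dhi : hhi + eta ^+ 4 < 1.
  by have := eX 3; move: e2 hi1; move: (eta ^+ 4) => x; lra.
have ndel : n%:R^-1 <= eta ^+ 4.
  by rewrite nE (_ : 16 = 12 + 4)%N// exprD ler_piMl ?exprn_ile1 ?(ltW e0) ?(ltW del0).
have lo1 : hhi - hlo <= 1 by lra.
have V u a : 0 < u < 1 -> 0 < a < 1 ->
    (Var (P n) (fun w => Pm (Kw (J n) (tau n a) h1 u w)) <= (CP * eta ^+ 16)%:E)%E.
  move=> u01 a01; have := conc n u h1 a n0 u01 _ a01; rewrite h10 h11 -nE => /(_ isT).
  by under eq_fun do rewrite PnE.
apply: le_trans (integrated_bound p n0 (mJ n) (J0 n) (ltW h10) (fun a i Y => mtau n a i Y)
  (fun a i => law n a i) (fun a => ind n a) V lohi lo1 alo0 aa ahi1 k0 (exprn_gt0 2 e0)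
    del0 dlo dhi ndel _) _.
  by rewrite mulr_ge0 ?exprn_ge0 ?(ltW e0) ?(ltW CP0).
rewrite lee_fin; apply: le_trans (bound_le_eta k p e01 (ltW CP0)) _.
rewrite -/A.
have nR : (1 : R) <= n%:R by rewrite ler1n.
apply: (@le_trans _ _ (rate * eta)).
  rewrite expr2 mulrA ler_pM2r// mulrC -ler_pdivlMr//.
(* It remains to compare exponents: [theta <= 7/8] gives [(theta - 1/2) / 6 <= 1/16]. *)
rewrite /eta powRN ler_pM2l// lef_pV2 ?posrE ?powR_gt0 ?(lt_le_trans ltr01 nR)//.
by apply: ler_powR => //; lra.
Qed.
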